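(* Let $\Sigma_*\in\mathcal N_0^d$ be a nondegenerate covariance matrix with eigenvalues $0<\lambda_d^*\le\dots\le\lambda_1^*$, let $0<r<\frac12\sqrt{\lambda_d^*}$, and let $B_r(\Sigma_* )=\{\Sigma\in\mathcal N_0^d: W_2(\Sigma,\Sigma_* )\le r\}$. Then: (i) $B_r(\Sigma_* )$ is compact in $\mathcal N_0^d$. (ii) The sectional curvature of $\mathcal N_0^d$ is uniformly bounded on $B_r(\Sigma_* )$. (iii) For all $\Sigma,\Sigma_1,\Sigma_2\in B_r(\Sigma_* )$ and all $V\in\operatorname{Sym}(d)$, $$(\sqrt{\lambda_d^*}-r)\|V\|_F\le\|V\|_\Sigma\le(\sqrt{\lambda_1^*}+r)\|V\|_F,$$ $$\|V\|_{\Sigma_2}\le\frac{\sqrt{\lambda_1^*}+r}{\sqrt{\lambda_d^*}-r}\,\|V\|_{\Sigma_1},$$ $$\|\Sigma_1-\Sigma_2\|_F\le 2\sqrt2\,\big(\sqrt{\lambda_1^*}+\sqrt{\lambda_d^*}\big)\,W_2(\Sigma_1,\Sigma_2).$$ (iv) For every $\Sigma\in B_r(\Sigma_* )$ and every $V\in\operatorname{Tan}_\Sigma\mathcal N_0^d$ with $\|V\|_\Sigma\le\frac12 r$, $$W_2(\Sigma,\operatorname{Exp}_\Sigma(V))=\|V\|_\Sigma.$$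
   Context: $\mathcal N_0^d$ is the set of centered Gaussian measures $\mathcal N(0,\Sigma)$ on $\mathbb R^d$ with $\Sigma$ symmetric positive definite; the measure is identified with $\Sigma$, so $\mathcal N_0^d$ is identified with the set of symmetric positive definite $d\times d$ matrices. $W_2$ is the 2-Wasserstein distance; for Gaussians $$W_2^2(\Sigma_0,\Sigma_1)=\operatorname{Tr}\Sigma_0+\operatorname{Tr}\Sigma_1-2\operatorname{Tr}\big(\Sigma_0^{1/2}\Sigma_1\Sigma_0^{1/2}\big)^{1/2}.$$ $\mathcal N_0^d$ carries the Bures-Wasserstein Riemannian structure: the tangent space $\operatorname{Tan}_\Sigma\mathcal N_0^d$ is identified with the space $\operatorname{Sym}(d)$ of symmetric real $d\times d$ matrices, where $V\in \operatorname{Sym}(d)$ corresponds to the velocity $\dot\Sigma=\Sigma V+V\Sigma$, with inner product $\langle U,V\rangle_\Sigma=\operatorname{Tr}(U\Sigma V)$ and norm $\|V\|_\Sigma^2=\operatorname{Tr}(V\Sigma V)$. The exponential map is $\operatorname{Exp}_\Sigma(V)=(\operatorname{Id}+V)\Sigma(\operatorname{Id}+V)$. $\|\cdot\|_F$ is the Frobenius norm. Sectional curvature refers to this Riemannian metric, and ''uniformly bounded'' means bounded over all points of the ball and all tangent 2-planes. *)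

(* Defs.v *)
From HB Require Import structures.
From mathcomp Require Import all_boot all_order all_algebra.
From mathcomp Require Import all_classical all_reals all_analysis.

Set Implicit Arguments.
Unset Strict Implicit.
Unset Printing Implicit Defensive.

Import Order.TTheory GRing.Theory Num.Theory.
Import numFieldNormedType.Exports.

Local Open Scope classical_set_scope.
Local Open Scope ring_scope.

Section Matrices.
Context {R : realType} {d : nat}.
Implicit Types S V X : 'M[R]_d.

Definition sym : set 'M[R]_d := [set V | V^T = V].

(* N_0^d: the nondegenerate centered Gaussian measure N(0,S) is represented
   by its covariance matrix S. *)
Definition spd : set 'M[R]_d :=
  [set S | sym S /\ forall u : 'rV[R]_d, u != 0 -> 0 < (u *m S *m u^T) 0 0].

Definition frobenius V : R := Num.sqrt (\sum_i \sum_j V i j ^+ 2).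

End Matrices.

Section Wasserstein.
Context {R : realType} {d : nat}.

(* R^d with its Borel sigma-algebra, as a measurable type. *)
Definition Rd := d.-tuple (measurableTypeR R).

(* mu = N(0,S), through the laws of the linear functionals of a random vector:
   for all u != 0, u.x is N(0, u S u^T). The second parameter of normal_prob is
   the standard deviation; u = 0 is left out because normal_prob 0 0 is by
   convention not a Dirac mass, and for a probability mu this loses nothing. *)
Definition is_gaussian (S : 'M[R]_d) (mu : set Rd -> \bar R) : Prop :=
  forall u : 'rV[R]_d, u != 0 ->
  forall A : set (measurableTypeR R), measurable A ->
    mu [set x | A (\sum_(i < d) u 0 i * tnth x i)] =
    normal_prob 0 (Num.sqrt ((u *m S *m u^T) 0 0)) A.

Definition gaussian_coupling (S0 S1 : 'M[R]_d)
    (p : probability (Rd * Rd)%type R) : Prop :=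
  is_gaussian S0 (pushforward p fst) /\ is_gaussian S1 (pushforward p snd).

Definition transport_cost (p : probability (Rd * Rd)%type R) : \bar R :=
  (\int[p]_z (\sum_(i < d) (tnth z.1 i - tnth z.2 i) ^+ 2)%:E)%E.

(* The 2-Wasserstein distance between N(0,S0) and N(0,S1). *)
Definition W2 (S0 S1 : 'M[R]_d) : R :=
  Num.sqrt (fine (ereal_inf
    [set transport_cost p | p in [set p | gaussian_coupling S0 S1 p]])).

End Wasserstein.

Section BuresWasserstein.
Context {R : realType} {d : nat}.
Implicit Types S U V W X Y Z : 'M[R]_d.

Definition W2_ball S r : set 'M[R]_d := [set S' | spd S' /\ W2 S' S <= r].

Definition bw_inner S U V : R := \tr (U *m S *m V).

Definition bw_norm S V : R := Num.sqrt (bw_inner S V V).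

Definition bw_exp S V : 'M[R]_d := (1%:M + V) *m S *m (1%:M + V).

(* A tangent vector V in Sym(d) has velocity S V + V S, its coordinate
   representation in the global chart N_0^d, an open subset of Sym(d). *)
Definition velocity S V : 'M[R]_d := S *m V + V *m S.

Definition of_velocity S X : 'M[R]_d :=
  xget 0 [set V | sym V /\ velocity S V = X].

(* The metric tensor in the chart: X and Y are velocities. *)
Definition bw_metric S X Y : R :=
  bw_inner S (of_velocity S X) (of_velocity S Y).

(* Christoffel symbols of the Levi-Civita connection in the chart:
   christoffel S X Y is nabla_X Y at S for the constant fields X and Y, given
   by the Koszul formula. The derivatives are along symmetric directions only,
   so they do not see the values of the metric off Sym(d). *)
Definition christoffel S X Y : 'M[R]_d :=
  xget 0 [set W | sym W /\ forall Z, sym Z ->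
    2 * bw_metric S W Z =
      'D_X (fun S' => bw_metric S' Y Z) S
    + 'D_Y (fun S' => bw_metric S' X Z) S
    - 'D_Z (fun S' => bw_metric S' X Y) S].

(* R(X,Y)Z = nabla_X nabla_Y Z - nabla_Y nabla_X Z for constant fields. *)
Definition curvature S X Y Z : 'M[R]_d :=
    'D_X (fun S' => christoffel S' Y Z) S
  - 'D_Y (fun S' => christoffel S' X Z) S
  + christoffel S X (christoffel S Y Z)
  - christoffel S Y (christoffel S X Z).

(* Sectional curvature at S of the plane spanned by the linearly independent
   tangent vectors U and V of Sym(d). *)
Definition sectional_curvature S U V : R :=
  let X := velocity S U in let Y := velocity S V in
  bw_metric S (curvature S X Y Y) X /
    (bw_inner S U U * bw_inner S V V - bw_inner S U V ^+ 2).

End BuresWasserstein.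

(* Main.v *)
(* If M is positive definite, x |-> M x pushes N(0,S) to N(0,MSM). Writing
   M = N^2, the inequality |x|^2 + |y|^2 <= |x-y|^2 + |Nx|^2 + |N^-1 y|^2,
   integrated against any coupling, shows that this map is optimal, so
   W2(S, MSM) = ||M - 1||_S; every pair S, S' is of this form. Hence the ball is
   the image under M |-> M Sstar M of the compact set of symmetric M with
   ||M - 1||_Sstar <= r, on which ||M - 1||_F < 1. If Sstar = A^2 and S = M Sstar M,
   then ||V||_S = ||VMA||_F differs from ||VA||_F by at most
   ||V||_F ||M - 1||_Sstar, which gives the norm bounds; part (iv) is the same
   formula for W2 with M = 1 + V.

   In the chart, the Christoffel symbols are -(USV + VSU), where U and V are the
   tangent vectors with velocities X and Y. With K = UV - VU and
   L the inverse of V |-> SV + VS, the numerator of the sectional curvature is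
   3/4 ||K + L(SK - KS)||^2, which lies between 0 and 3/4 tr(K S K^T). Making V
   orthogonal to U changes neither K nor the Gram determinant, and the norm
   bounds conclude. *)
Require Import Defs.
From mathcomp Require Import all_boot all_order all_algebra.
From mathcomp Require Import all_classical all_reals all_analysis.
From mathcomp Require Import measurable_realfun complex ring lra.
Import Order.TTheory GRing.Theory Num.Theory.
Import numFieldNormedType.Exports.
Local Open Scope classical_set_scope.
Local Open Scope ring_scope.
Set Implicit Arguments.
Unset Strict Implicit.
Unset Printing Implicit Defensive.

(** * Spectral theory of symmetric matrices *)

(** No density in dimension $d$ ever appears: a Gaussian law is known only through its linear
    functionals, and the quadratic costs require only their second moments. The upper bound on $W_2$
    does require Gaussian vectors to exist; otherwise the infimum could run over an empty set of
    couplings. [of_velocity] and [christoffel] are choices of a solution to an equation, so they can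
    be differentiated only after explicit formulas are known at all nearby points of a symmetric
    line. These formulas are therefore proved for every symmetric [S] such that $V \mapsto SV+VS$ is
    invertible, a condition that visibly persists near a point. The factor 3/4 has a geometric
    source: $A \mapsto AA^T$ is a Riemannian submersion from the invertible matrices with the flat
    metric onto the positive definite ones, so by O'Neill's formula the curvature is 3/4 of the
    squared vertical part of a bracket. Since the curvature is defined here in coordinates, the
    formula is verified directly, as a linear identity between traces of words in symmetric matrices
    taken up to rotation and reversal. *)

Lemma eigenvalue_sym (R : rcfType) n (A : 'M[R]_n.+1) :
  A^T = A -> exists a, eigenvalue A a.
Proof.
move=> As; pose AC := map_mx (real_complex R) A.
(* Over the complex extension the matrix is Hermitian, so its spectral diagonal is real. A diagonal
   entry is a root of the complexified characteristic polynomial, hence of the real one, because the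
   embedding is a field morphism. *)
have hA : AC \is hermsymmx.
  apply/is_hermitianmxP; rewrite expr0 scale1r -map_trmx -map_mx_comp.
  rewrite map_trmx As -[LHS]/AC; apply/matrixP => i j; rewrite !mxE /=.
  by apply/esym/conj_Creal; rewrite complex_real.
have /mxOverP/(_ 0 0)/complex_realP[a aE] := hermitian_spectral_diag_real hA.
have AE := orthomx_spectralP (hermitian_normalmx hA).
exists a; rewrite eigenvalue_root_char.
rewrite -(fmorph_root (real_complex R)) map_char_poly -eigenvalue_root_char.
apply/eigenvalueP; exists (row 0 (spectralmx AC)).
  rewrite -/AC.
  rewrite {2}AE -row_mul 2!mulmxA mulmxV ?spectral_unit// mul1mx.
  apply/rowP => j; rewrite !mxE (bigD1 (0 : 'I_n.+1))//= big1 ?addr0.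
    by rewrite !mxE eqxx mulr1n aE.
  by move=> k k0; rewrite !mxE eq_sym (negbTE k0) mulr0n mul0r.
have := spectral_unit AC; rewrite -row_free_unit => /row_freeP[B PB].
apply/eqP => P0; have := congr1 (fun X => row 0 X 0 0) PB.
rewrite row_mul P0 mul0mx !mxE eqxx => /eqP.
by rewrite eq_sym oner_eq0.
Qed.

Section householder.
Variables (R : realFieldType) (n : nat).

Lemma sqnorm_ge0 m (u : 'rV[R]_m) : 0 <= (u *m u^T) 0 0.
Proof. by rewrite mxE sumr_ge0// => i _; rewrite mxE -expr2 sqr_ge0. Qed.

Lemma sqnorm_eq0 m (u : 'rV[R]_m) : ((u *m u^T) 0 0 == 0) = (u == 0).
Proof.
apply/idP/eqP => [|->]; last by rewrite mul0mx mxE.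
rewrite mxE psumr_eq0; last by move=> i _; rewrite mxE -expr2 sqr_ge0.
move=> /allP u0; apply/rowP => i; have := u0 i (mem_index_enum i).
by rewrite !mxE -expr2 sqrf_eq0 => /eqP.
Qed.

(* The reflection exchanging [e_0] and the unit vector [v]. *)
Lemma householder (v : 'rV[R]_n.+1) : v *m v^T = 1%:M ->
  exists H : 'M[R]_n.+1, [/\ H^T = H, H *m H = 1%:M & delta_mx 0 0 *m H = v].
Proof.
move=> v1; pose e : 'rV[R]_n.+1 := delta_mx 0 0; pose w := v - e.
have [w0|wn0] := eqVneq w 0.
  exists 1%:M; rewrite trmx1 !mulmx1; split => //.
  by apply/eqP; rewrite eq_sym -subr_eq0; apply/eqP.
pose q := (w *m w^T) 0 0.
have q0 : q != 0 by rewrite /q sqnorm_eq0.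
have wwE : w *m w^T = q%:M by rewrite [LHS]mx11_scalar.
have e1 : e *m e^T = 1%:M.
  by rewrite trmx_delta mul_delta_mx; apply/matrixP => i j; rewrite !ord1 !mxE.
have veE : v *m e^T = e *m v^T.
  rewrite -[RHS]trmxK trmx_mul trmxK [_ *m _]mx11_scalar.
  by rewrite tr_scalar_mx.
have qE : q = - 2 * (e *m w^T) 0 0.
  rewrite /q /w linearB /= mulmxBl !mulmxBr v1 e1 veE.
  by rewrite !mxE eqxx; lra.
exists (1%:M - (2 / q) *: (w^T *m w)); split.
- by rewrite linearB /= trmx1 linearZ /= trmx_mul trmxK.
- have WW : (w^T *m w) *m (w^T *m w) = q *: (w^T *m w).
    by rewrite -mulmxA (mulmxA w) wwE mul_scalar_mx -scalemxAr.
  rewrite mulmxBr mulmx1 mulmxBl mul1mx -scalemxAl -scalemxAr WW !scalerA.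
  have -> : 2 / q * (2 / q) * q = 2 / q + 2 / q by field.
  by rewrite scalerDl opprB addrK subrK.
- rewrite mulmxBr mulmx1 -scalemxAr mulmxA [_ *m w^T]mx11_scalar.
  rewrite mul_scalar_mx scalerA -/e.
  have -> : 2 / q * (e *m w^T) 0 0 = -1.
    have : (e *m w^T) 0 0 = - q / 2 by rewrite qE; field.
    by move=> ->; field.
  by rewrite scaleN1r opprK /w addrC subrK.
Qed.
End householder.

(** Deflation: conjugating by a reflection that sends the first basis vector to a unit eigenvector
    splits off the eigenvalue and leaves a symmetric block of size [n]. Vectors are rows, so the
    eigenvectors are the rows of [P]. *)
Lemma spectral_sym (R : rcfType) n (A : 'M[R]_n) : A^T = A ->
  exists (P : 'M[R]_n) (D : 'rV[R]_n), P *m P^T = 1%:M /\ A = P^T *m diag_mx D *m P.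
Proof.
elim: n A => [|n IHn] A As.
  by exists 1%:M, 0; split; apply/matrixP => -[].
have [a /eigenvalueP[v0 v0A v0n0]] := eigenvalue_sym As.
pose s := Num.sqrt ((v0 *m v0^T) 0 0); pose v := s^-1 *: v0.
have s0 : s != 0 by rewrite sqrtr_eq0 -ltNge lt_def sqnorm_ge0 sqnorm_eq0 v0n0.
have v1 : v *m v^T = 1%:M.
  rewrite linearZ /= -scalemxAl -scalemxAr scalerA [v0 *m _]mx11_scalar.
  rewrite scale_scalar_mx -[X in _ * X]sqr_sqrtr ?sqnorm_ge0// -/s.
  by congr (_%:M); field.
have vA : v *m A = a *: v by rewrite -scalemxAl v0A !scalerA mulrC.
have [H [Hs HH He]] := householder v1.
have [B BE] : {B : 'M[R]_(1 + n) | B = H *m A *m H} by eexists.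
have Bs : B^T = B by rewrite BE !trmx_mul Hs As mulmxA.
have eB : delta_mx 0 0 *m B = a *: (delta_mx 0 0 : 'rV_(1 + n)).
  rewrite BE !mulmxA He vA -scalemxAl; congr (_ *: _).
  by rewrite -He -mulmxA HH mulmx1.
have B0 : row 0 B = a *: delta_mx 0 0 by rewrite rowE.
have ulE : ulsubmx B = a%:M.
  rewrite [LHS]mx11_scalar; congr (_%:M).
  have := congr1 (fun X : 'rV_(1 + n) => X 0 0) B0; rewrite !mxE /= mulr1 => <-.
  by congr (B _ _); apply/val_inj.
have urE : ursubmx B = 0.
  apply/matrixP => i j; rewrite ord1 !mxE.
  have := congr1 (fun X : 'rV_(1 + n) => X 0 (rshift 1 j)) B0.
  rewrite !mxE /= mulr0 => <-.
  by congr (B _ _); apply/val_inj.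
have dlE : dlsubmx B = 0 by rewrite -Bs -trmx_ursub urE trmx0.
have /IHn[Q [D [QQ dE]]] : (drsubmx B)^T = drsubmx B by rewrite trmx_drsub Bs.
have blkE : B = block_mx a%:M 0 0 (drsubmx B).
  by rewrite -[LHS]submxK ulE urE dlE.
pose Q1 : 'M[R]_(1 + n) := block_mx 1%:M 0 0 Q.
have Q1T : Q1^T = block_mx 1%:M 0 0 Q^T :> 'M[R]_(1 + n).
  by rewrite /Q1 tr_block_mx !trmx0 trmx1.
have Q1Q1 : Q1 *m Q1^T = 1%:M.
  rewrite Q1T /Q1 mulmx_block !mul0mx !mulmx0 !mul1mx !addr0 add0r QQ.
  by rewrite -scalar_mx_block.
have Q1B : Q1^T *m diag_mx (row_mx a%:M D) *m Q1 = B.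
  rewrite Q1T /Q1 diag_mx_row !mulmx_block.
  rewrite !mul0mx !mulmx0 !mul1mx !mulmx1 !addr0 !add0r !mul0mx -dE [RHS]blkE.
  by congr block_mx; apply/matrixP => i j; rewrite !ord1 !mxE.
exists (Q1 *m H), (row_mx a%:M D); split.
  by rewrite trmx_mul Hs mulmxA -(mulmxA Q1) HH mulmx1.
have -> : A = H *m B *m H.
  by rewrite BE -!mulmxA HH mulmx1 mulmxA HH mul1mx.
by rewrite -Q1B trmx_mul Hs !mulmxA.
Qed.

(** * Positive definite matrices: square roots and transport maps *)

Section spd.
Variables (R : realType) (n : nat).
Implicit Types (A S M N C : 'M[R]_n) (u v : 'rV[R]_n).

Lemma quad_diag (P : 'M[R]_n) (D u : 'rV[R]_n) :
  (u *m (P^T *m diag_mx D *m P) *m u^T) 0 0 =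
  \sum_i D 0 i * ((u *m P^T) 0 i) ^+ 2.
Proof.
have -> : u *m (P^T *m diag_mx D *m P) *m u^T =
    (u *m P^T) *m diag_mx D *m (u *m P^T)^T.
  by rewrite trmx_mul trmxK !mulmxA.
move: (u *m P^T) => w; rewrite mul_mx_diag mxE; apply: eq_bigr => i _.
by rewrite !mxE; ring.
Qed.

Lemma sqnorm_orthogonal (P : 'M[R]_n) (u : 'rV[R]_n) : P *m P^T = 1%:M ->
  \sum_i ((u *m P^T) 0 i) ^+ 2 = (u *m u^T) 0 0.
Proof.
move=> PP.
have -> : u *m u^T = u *m (P^T *m diag_mx (const_mx 1) *m P) *m u^T.
  by rewrite diag_const_mx mulmx1 (mulmx1C PP) mulmx1.
by rewrite quad_diag; apply: eq_bigr => i _; rewrite [const_mx _ _ _]mxE mul1r.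
Qed.

Lemma spectral_row_eigen (P : 'M[R]_n) (D : 'rV[R]_n) i : P *m P^T = 1%:M ->
  row i P *m (P^T *m diag_mx D *m P) = D 0 i *: row i P.
Proof.
move=> PP; rewrite -row_mul !mulmxA PP mul1mx; apply/rowP => j.
rewrite !mxE (bigD1 i)//= big1 ?addr0.
  by rewrite !mxE eqxx mulr1n.
by move=> k k0; rewrite !mxE eq_sym (negbTE k0) mulr0n mul0r.
Qed.

Lemma sqnorm_orthogonal_row (P : 'M[R]_n) i : P *m P^T = 1%:M ->
  (row i P *m (row i P)^T) 0 0 = 1.
Proof.
move=> PP; have <- : (P *m P^T) i i = 1 by rewrite PP mxE eqxx.
rewrite !mxE.
by apply: eq_bigr => k _; rewrite !mxE.
Qed.

Lemma spd_spectral S : spd S -> exists (P : 'M[R]_n) (D : 'rV[R]_n),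
  [/\ P *m P^T = 1%:M, S = P^T *m diag_mx D *m P & forall i, 0 < D 0 i].
Proof.
move=> [Ss Sp]; have [P [D [PP SE]]] := spectral_sym Ss.
exists P, D; split => // i.
have r1 := sqnorm_orthogonal_row i PP.
have : 0 < (row i P *m S *m (row i P)^T) 0 0.
  apply: Sp; apply/eqP => r0; move: r1; rewrite r0 mul0mx mxE => /eqP.
  by rewrite eq_sym oner_eq0.
by rewrite SE spectral_row_eigen// -scalemxAl mxE r1 mulr1.
Qed.

Lemma spd_orthogonal_diag (P : 'M[R]_n) (D : 'rV[R]_n) : P *m P^T = 1%:M ->
  (forall i, 0 < D 0 i) -> spd (P^T *m diag_mx D *m P).
Proof.
move=> PP D0; split; first by rewrite /sym/= !trmx_mul trmxK tr_diag_mx mulmxA.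
move=> u u0; rewrite quad_diag.
have s0 i : true -> 0 <= D 0 i * ((u *m P^T) 0 i) ^+ 2.
  by move=> _; rewrite mulr_ge0 ?sqr_ge0// ltW.
rewrite lt_def sumr_ge0// andbT psumr_eq0//; apply/negP => /allP h.
move/negP: u0; apply; rewrite -sqnorm_eq0 -(sqnorm_orthogonal _ PP).
rewrite big1// => i _; apply/eqP; have := h i (mem_index_enum i) => /=.
by rewrite mulf_eq0 gt_eqF.
Qed.

Lemma spd_sqrt S : spd S -> exists2 N, spd N & N *m N = S.
Proof.
move=> /spd_spectral[P [D [PP SE D0]]].
exists (P^T *m diag_mx (\row_i Num.sqrt (D 0 i)) *m P).
  by apply: spd_orthogonal_diag => // i; rewrite mxE sqrtr_gt0.
rewrite !mulmxA -(mulmxA _ P) PP mulmx1 -(mulmxA P^T) SE; congr (_ *m _ *m _).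
rewrite mulmx_diag; congr diag_mx; apply/rowP => i; rewrite !mxE.
by rewrite -expr2 sqr_sqrtr// ltW.
Qed.

Lemma spd_unit S : spd S -> S \in unitmx.
Proof.
move=> [_ Sp]; rewrite -row_free_unit; apply: inj_row_free => u uS.
apply/eqP; apply: contraT => /Sp; rewrite uS mul0mx mxE ltxx.
by [].
Qed.

Lemma spd_congr S C : spd S -> C \in unitmx -> spd (C *m S *m C^T).
Proof.
move=> [Ss Sp] Cu; split; first by rewrite /sym/= !trmx_mul trmxK Ss mulmxA.
move=> u u0; have := Sp (u *m C); rewrite trmx_mul !mulmxA; apply.
apply: contra u0 => /eqP uC; rewrite -[u](mulmxK Cu) uC mul0mx.
by [].
Qed.

Lemma spd_inv S : spd S -> spd (invmx S).
Proof.
move=> sS; have Su := spd_unit sS.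
have := spd_congr sS (_ : invmx S \in unitmx).
by rewrite unitmx_inv => /(_ Su); rewrite mulVmx// mul1mx trmx_inv sS.1.
Qed.

(** The witness is $A^{-1}(A S_1 A)^{1/2}A^{-1}$ with $A = S_0^{1/2}$, the matrix of the optimal
    transport map from $\mathcal N(0,S_0)$ to $\mathcal N(0,S_1)$. *)
Lemma spd_transport S0 S1 : spd S0 -> spd S1 ->
  exists2 M, spd M & M *m S0 *m M = S1.
Proof.
move=> /spd_sqrt[A sA <-] sS1; have Au := spd_unit sA.
have [N sN NN] := spd_sqrt (spd_congr sS1 Au).
have As : A^T = A := sA.1; have Bs : (invmx A)^T = invmx A by rewrite trmx_inv As.
exists (invmx A *m N *m invmx A).
  by rewrite -{2}Bs; apply: spd_congr => //; rewrite unitmx_inv.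
rewrite !mulmxA (mulmxKV Au) (mulmxK Au) -(mulmxA _ N N) NN As.
by rewrite !mulmxA mulVmx// mul1mx mulmxK.
Qed.

End spd.

(** Every spectral diagonal entry is a root of the characteristic polynomial, hence lies in [lam],
    between its last and first entries. The quadratic form is a sum of squares weighted by these
    entries. *)
Lemma char_poly_bounds (R : realType) d (S : 'M[R]_d.+1) (lam : d.+1.-tuple R)
    (u : 'rV[R]_d.+1) :
  S^T = S ->
  char_poly S = \prod_(x <- lam) ('X - x%:P) ->
  sorted (fun x y => y <= x) lam ->
  tnth lam ord_max * (u *m u^T) 0 0 <= (u *m S *m u^T) 0 0
    <= tnth lam ord0 * (u *m u^T) 0 0.
Proof.
move=> Ss cS lams; have [P [D [PP SE]]] := spectral_sym Ss.
have Dl i : tnth lam ord_max <= D 0 i <= tnth lam ord0.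
  have : D 0 i \in lam.
    rewrite -root_prod_XsubC -cS -eigenvalue_root_char; apply/eigenvalueP.
    exists (row i P); first by rewrite SE spectral_row_eigen.
    apply/eqP => r0; have := sqnorm_orthogonal_row i PP.
    by rewrite r0 mul0mx mxE => /eqP; rewrite eq_sym oner_eq0.
  move=> /tnthP[j ->].
  have st : transitive (fun x y : R => y <= x).
    by move=> x y z yx zx; exact: le_trans zx yx.
  have mono : forall a b : 'I_d.+1, (a <= b)%N -> tnth lam b <= tnth lam a.
    move=> a b ab; rewrite !(tnth_nth 0).
    apply: (sorted_leq_nth st) => //; last 2 first.
      by rewrite inE size_tuple.
      by rewrite inE size_tuple.
  by rewrite !mono// -ltnS.
rewrite SE quad_diag -(sqnorm_orthogonal u PP) !mulr_sumr.
by apply/andP; split; apply: ler_sum => i _; apply: ler_wpM2r;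
  rewrite ?sqr_ge0//; case/andP: (Dl i).
Qed.

(** * Frobenius norm and trace inequalities *)

Section hilbert_schmidt.
Variable R : realType.

(** The Frobenius norm in trace form. Rectangular shapes are allowed so that row vectors obey the
    same Cauchy-Schwarz and product inequalities. *)
Definition hs_norm m n (A : 'M[R]_(m, n)) : R := Num.sqrt (\tr (A *m A^T)).

Lemma mxtrace_mulT m n (A B : 'M[R]_(m, n)) :
  \tr (A *m B^T) = \sum_i \sum_j A i j * B i j.
Proof.
by rewrite /mxtrace; apply: eq_bigr => i _; rewrite mxE; apply: eq_bigr => j _;
  rewrite mxE.
Qed.

Lemma mxtrace_sqr_ge0 m n (A : 'M[R]_(m, n)) : 0 <= \tr (A *m A^T).
Proof.
rewrite mxtrace_mulT sumr_ge0// => i _; rewrite sumr_ge0// => j _.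
by rewrite -expr2 sqr_ge0.
Qed.

Lemma mxtrace_sqr_eq0 m n (A : 'M[R]_(m, n)) : \tr (A *m A^T) = 0 -> A = 0.
Proof.
rewrite mxtrace_mulT => /eqP; rewrite psumr_eq0; last first.
  by move=> i _; rewrite sumr_ge0// => j _; rewrite -expr2 sqr_ge0.
move=> /allP h; apply/matrixP => i j; have := h i (mem_index_enum i).
rewrite psumr_eq0; last by move=> k _; rewrite -expr2 sqr_ge0.
by move=> /allP /(_ j (mem_index_enum j)); rewrite -expr2 sqrf_eq0 mxE => /eqP.
Qed.

Lemma mxtrace_mulTC m n (A B : 'M[R]_(m, n)) : \tr (A *m B^T) = \tr (B *m A^T).
Proof. by rewrite -mxtrace_tr trmx_mul trmxK. Qed.

Lemma mxtrace_cauchy m n (A B : 'M[R]_(m, n)) :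
  \tr (A *m B^T) ^+ 2 <= \tr (A *m A^T) * \tr (B *m B^T).
Proof.
set a := \tr (A *m A^T); set b := \tr (B *m B^T); set c := \tr (A *m B^T).
have [b0|b0] := eqVneq b 0.
  have B0 := mxtrace_sqr_eq0 b0.
  by rewrite b0 mulr0 /c B0 trmx0 mulmx0 mxtrace0 expr0n.
have bp : 0 < b by rewrite lt_def b0 mxtrace_sqr_ge0.
(* The squared norm of $bA - cB$ equals $b(ab - c^2)$. *)
have := mxtrace_sqr_ge0 (b *: A + (- c) *: B).
rewrite [(_ + _)^T]linearD /= ![(_ *: _)^T]linearZ /= mulmxDl !mulmxDr.
rewrite -!scalemxAl -!scalemxAr !mxtraceD !mxtraceZ (mxtrace_mulTC B A).
rewrite -/a -/b -/c => h.
have : 0 <= b * (a * b - c ^+ 2) by apply: le_trans h _; lra.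
by rewrite pmulr_rge0// subr_ge0.
Qed.

Lemma hs_norm_ge0 m n (A : 'M[R]_(m, n)) : 0 <= hs_norm A.
Proof. exact: sqrtr_ge0. Qed.

Lemma hs_norm_sqr m n (A : 'M[R]_(m, n)) : hs_norm A ^+ 2 = \tr (A *m A^T).
Proof. by rewrite sqr_sqrtr ?mxtrace_sqr_ge0. Qed.

Lemma hs_norm_cauchy m n (A B : 'M[R]_(m, n)) :
  `|\tr (A *m B^T)| <= hs_norm A * hs_norm B.
Proof.
rewrite -(@ler_pXn2r _ 2%N)// ?nnegrE ?mulr_ge0 ?hs_norm_ge0//.
by rewrite exprMn !hs_norm_sqr real_normK ?num_real// mxtrace_cauchy.
Qed.

Lemma hs_norm_triangle m n (A B : 'M[R]_(m, n)) :
  hs_norm (A + B) <= hs_norm A + hs_norm B.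
Proof.
rewrite -(@ler_pXn2r _ 2%N)// ?nnegrE ?addr_ge0 ?hs_norm_ge0//.
rewrite sqrrD !hs_norm_sqr linearD /= mulmxDl !mulmxDr !linearD /=.
rewrite (mxtrace_mulTC B A).
have := hs_norm_cauchy A B; have := ler_norm (\tr (A *m B^T)); lra.
Qed.

Lemma hs_normN m n (A : 'M[R]_(m, n)) : hs_norm (- A) = hs_norm A.
Proof. by rewrite /hs_norm linearN /= mulmxN mulNmx opprK. Qed.

Lemma hs_norm_trmx m n (A : 'M[R]_(m, n)) : hs_norm A^T = hs_norm A.
Proof. by rewrite /hs_norm trmxK mxtrace_mulC. Qed.

(** Each entry of the product is an inner product of a row of [A] with a column of [B];
    Cauchy-Schwarz is applied entry by entry and summed. *)
Lemma hs_normM m n p (A : 'M[R]_(m, n)) (B : 'M[R]_(n, p)) :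
  hs_norm (A *m B) <= hs_norm A * hs_norm B.
Proof.
rewrite -(@ler_pXn2r _ 2%N)// ?nnegrE ?mulr_ge0 ?hs_norm_ge0//.
rewrite exprMn !hs_norm_sqr (mxtrace_mulC B) -{4}[B]trmxK !mxtrace_mulT.
rewrite mulr_suml; apply: ler_sum => i _; rewrite mulr_sumr.
apply: ler_sum => j _; rewrite -expr2.
have := mxtrace_cauchy (row i A) (row j B^T).
rewrite !mxtrace_mulT !big_ord1; congr (_ ^+ 2 <= _ * _).
- by rewrite mxE; apply: eq_bigr => k _; rewrite !mxE.
- by apply: eq_bigr => k _; rewrite !mxE.
- by apply: eq_bigr => k _; rewrite !mxE.
Qed.

Lemma frobeniusE d (V : 'M[R]_d) : frobenius V = hs_norm V.
Proof.
by congr Num.sqrt; rewrite mxtrace_mulT; apply: eq_bigr => i _;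
  apply: eq_bigr => j _; rewrite expr2.
Qed.

(** The device that turns bounds on a quadratic form into bounds on traces, row by row. *)
Lemma mxtrace_quad m n (V : 'M[R]_(m, n)) (S : 'M[R]_n) :
  \tr (V *m S *m V^T) = \sum_i (row i V *m S *m (row i V)^T) 0 0.
Proof.
rewrite /mxtrace; apply: eq_bigr => i _.
by rewrite -row_mul !mxE; apply: eq_bigr => k _; rewrite !mxE.
Qed.

Lemma quad_hs_bound m n (V : 'M[R]_(m, n)) (S : 'M[R]_n) (c : R) :
  (forall u : 'rV[R]_n, (u *m S *m u^T) 0 0 <= c * (u *m u^T) 0 0) ->
  \tr (V *m S *m V^T) <= c * \tr (V *m V^T).
Proof.
move=> h; rewrite mxtrace_quad -[V in _ * \tr (V *m _)]mulmx1 mxtrace_quad.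
by rewrite mulr_sumr; apply: ler_sum => i _; rewrite mulmx1.
Qed.

Lemma quad_hs_lbound m n (V : 'M[R]_(m, n)) (S : 'M[R]_n) (c : R) :
  (forall u : 'rV[R]_n, c * (u *m u^T) 0 0 <= (u *m S *m u^T) 0 0) ->
  c * \tr (V *m V^T) <= \tr (V *m S *m V^T).
Proof.
move=> h; rewrite mxtrace_quad -[V in _ * \tr (V *m _)]mulmx1 mxtrace_quad.
by rewrite mulr_sumr; apply: ler_sum => i _; rewrite mulmx1.
Qed.

End hilbert_schmidt.

(** * One-dimensional Gaussian integrals *)

Section affine.
Variable R : realType.
Notation mu := (@lebesgue_measure R).
Local Notation BR := (measurableTypeR R).
Implicit Types (a b : R) (A : set BR).

Lemma measurable_affine a b : measurable_fun [set: BR] (fun x : BR => a * x + b : BR).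
Proof. by apply: measurable_funD => //; apply: measurable_funM. Qed.

Lemma lebesgue_measure_affine a b A : a != 0 -> measurable A ->
  mu A = (`|a|%:E * pushforward mu (fun x : BR => a * x + b : BR)%R A)%E.
Proof.
move=> a0 mA; have maff := measurable_affine a b.
apply: (@lebesgue_measure_unique _ (mscale (NngNum (normr_ge0 a))
  (pushforward mu (fun x : BR => a * x + b : BR)))) => // _ [[p q] /= _ <-].
have -> : mscale (NngNum (normr_ge0 a)) (pushforward mu (fun x : BR => a * x + b : BR))
    `]p, q]%classic = (`|a|%:E * mu ((fun x : BR => (a * x + b)%R) @^-1` `]p, q]))%E by [].
rewrite lebesgue_measure_itv /=.
have [a_gt0|a_lt0|a00] := ltgtP 0 a; last by rewrite -a00 eqxx in a0.
- rewrite (_ : _ @^-1` _ = `](p - b) / a, (q - b) / a]%classic); last first.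
    apply/seteqP; split => x /=; rewrite !in_itv/= ltr_pdivrMr// ler_pdivlMr//;
    by move=> /andP[? ?]; apply/andP; split; lra.
  rewrite lebesgue_measure_itv /= !lte_fin ltr_pM2r ?invr_gt0// ltrD2r.
  case: ifP => _; last by rewrite mule0.
  rewrite gtr0_norm// -!EFinB -EFinM; congr (_%:E).
  by field.
(* A negative slope exchanges the open and the closed end of the interval; the length is
   unaffected. *)
- rewrite (_ : _ @^-1` _ = `[(q - b) / a, (p - b) / a[%classic); last first.
    apply/seteqP; split => x /=; rewrite !in_itv/= ltr_ndivlMr// ler_ndivrMr//;
    by move=> /andP[? ?]; apply/andP; split; lra.
  rewrite lebesgue_measure_itv /= !lte_fin ltr_nM2r ?invr_lt0// ltrD2r.
  case: ifP => _; last by rewrite mule0.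
  rewrite ltr0_norm// -!EFinB -EFinM; congr (_%:E).
  by field.
Qed.

Lemma ge0_integral_affine a b (f : BR -> \bar R) : a != 0 ->
  measurable_fun [set: BR] f -> (forall x, 0 <= f x)%E ->
  (\int[mu]_x f x = `|a|%:E * \int[mu]_x f (a * x + b)%R)%E.
Proof.
move=> a0 mf f0; have maff := measurable_affine a b.
rewrite (@eq_measure_integral _ _ _ _ (mscale (NngNum (normr_ge0 a))
    (pushforward mu (fun x : BR => a * x + b : BR)%R))); last first.
  by move=> A mA _; exact: lebesgue_measure_affine.
by rewrite ge0_integral_mscale// ge0_integral_pushforward.
Qed.

Lemma measurable_EFin_normal_pdf m s :
  measurable_fun [set: BR] (fun x : BR => (normal_pdf m s x)%:E).
Proof.
have : measurable_fun [set: R] (EFin \o normal_pdf m s).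
  apply/measurable_EFinP.
  exact: measurable_normal_pdf.
exact.
Qed.

Lemma normal_prob_affine a b s A : a != 0 -> s != 0 -> measurable A ->
  normal_prob b (`|a| * s) A =
  normal_prob 0 s ((fun x : BR => a * x + b : BR) @^-1` A).
Proof.
move=> a0 s0 mA; have maff := measurable_affine a b.
have mA' : measurable ((fun x : BR => a * x + b : BR) @^-1` A).
  by rewrite -[X in measurable X]setTI; exact: maff.
have as0 : `|a| * s != 0 by rewrite mulf_neq0// normr_eq0.
have mpdf m t (B : set BR) : measurable B -> measurable_fun [set: BR]
    (((fun x => (normal_pdf m t x)%:E) \_ B) : BR -> \bar R).
  move=> mB; apply/(measurable_restrictT _ mB)/measurable_funTS.
  exact: measurable_EFin_normal_pdf.
have pdf_ge0 m t (B : set BR) x :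
    (0 <= ((fun x => (normal_pdf m t x)%:E) \_ B) x)%E.
  by rewrite patchE; case: ifP => // _; rewrite lee_fin normal_pdf_ge0.
rewrite /normal_prob integral_mkcond (ge0_integral_affine b a0)//; last first.
  exact: mpdf.
rewrite [RHS]integral_mkcond -ge0_integralZl; first last.
- by rewrite lee_fin.
- by move=> x _; exact: pdf_ge0.
- exact: (measurableT_comp (mpdf b (`|a| * s) A mA) maff).
- exact: measurableT.
apply: eq_integral => x _; rewrite !patchE /=.
have -> : (x \in (fun x : BR => a * x + b : BR) @^-1` A) = (a * x + b \in A) by [].
case: ifPn => _; last by rewrite mule0.
rewrite -EFinM; congr (_%:E).
rewrite !normal_pdfE// /normal_peak /normal_fun mulrA; congr (_ * expR _).
- rewrite exprMn real_normK ?num_real// -mulrA -mulrnAr sqrtrM ?sqr_ge0//.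
  rewrite sqrtr_sqr invfM mulrA mulfV ?mul1r//.
  by rewrite normr_eq0.
- rewrite exprMn real_normK ?num_real//; field.
  by rewrite a0 s0.
Qed.

(** The Radon-Nikodym derivative of [normal_prob m s] and the density [normal_pdf m s] have equal
    integrals over all measurable sets, hence agree almost everywhere. *)
Lemma ge0_integral_normal_prob m s (f : BR -> \bar R) :
  measurable_fun [set: BR] f -> (forall x, 0 <= f x)%E ->
  (\int[normal_prob m s]_x f x = \int[mu]_x (f x * (normal_pdf m s x)%:E))%E.
Proof.
move=> mf f0; have dom := normal_prob_dominates m s.
rewrite -(Radon_Nikodym_SigmaFinite.change_of_variables dom f0 measurableT mf).
have mRN := measurable_int _ (Radon_Nikodym_SigmaFinite.f_integrable dom).
apply: ge0_ae_eq_integral => //.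
- exact: emeasurable_funM.
- by apply: emeasurable_funM => //; exact: measurable_EFin_normal_pdf.
- by move=> x _; rewrite mule_ge0// Radon_Nikodym_SigmaFinite.f_ge0.
- by move=> x _; rewrite mule_ge0// lee_fin normal_pdf_ge0.
- apply: ae_eqe_mul2l; apply: integral_ae_eq => //.
  + exact: Radon_Nikodym_SigmaFinite.f_integrable.
  + exact: measurable_EFin_normal_pdf.
  + by move=> E _ mE; rewrite -(Radon_Nikodym_SigmaFinite.f_integral dom).
Qed.

Lemma normal_peakM (q s : R) : 0 < q -> 0 < s ->
  q * normal_peak (s * q) = normal_peak s.
Proof.
move=> q0 s0; rewrite /normal_peak.
have -> : (s * q) ^+ 2 * pi *+ 2 = (q ^+ 2) * (s ^+ 2 * pi *+ 2) by ring.
rewrite sqrtrM ?sqr_ge0// sqrtr_sqr gtr0_norm// invfM mulrA mulfV ?mul1r//.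
by rewrite gt_eqF.
Qed.

Lemma normal_pdf_scale (q s x : R) : 0 < q -> 0 < s ->
  q * normal_pdf 0 (s * q) x =
  normal_pdf 0 s x * expR ((1 - q ^- 2) / (s ^+ 2 *+ 2) * x ^+ 2).
Proof.
move=> q0 s0; rewrite !normal_pdfE ?mulf_neq0 ?gt_eqF// mulrA normal_peakM//.
rewrite -[RHS]mulrA; congr (_ * _); rewrite /normal_fun -expRD; congr expR.
by field; rewrite !gt_eqF.
Qed.

(* Comparing the densities of [N(0, s^2 q^2)] and [N(0, s^2)] through
   [1 + y <= expR y] brackets the second moment; then [q] tends to [1]. *)
Lemma normal_second_moment (s : R) : 0 < s ->
  (\int[normal_prob 0 s]_x (x ^+ 2)%:E = (s ^+ 2)%:E)%E.
Proof.
move=> s0.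
have msq : measurable_fun [set: BR] (fun x : BR => (x ^+ 2)%:E).
  have : measurable_fun [set: R] (EFin \o (fun x : R => x ^+ 2)).
    by apply/measurable_EFinP; exact: measurable_funX.
  exact.
rewrite ge0_integral_normal_prob//; last by move=> x; rewrite lee_fin sqr_ge0.
under eq_integral do rewrite -EFinM.
set c := (X in X = _).
have mpdf q := measurable_EFin_normal_pdf 0 q.
have mint : measurable_fun [set: BR] (fun x : BR => (x ^+ 2 * normal_pdf 0 s x)%:E).
  by have := emeasurable_funM msq (mpdf s); exact.
have int_ge0 x : (0 <= (x ^+ 2 * normal_pdf 0 s x)%:E)%E.
  by rewrite lee_fin mulr_ge0 ?sqr_ge0 ?normal_pdf_ge0.
have c_ge0 : (0 <= c)%E by apply: integral_ge0.
pose k q : R := (1 - q ^- 2) / (s ^+ 2 *+ 2).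
have pw q x : 0 < q ->
    normal_pdf 0 s x + k q * (x ^+ 2 * normal_pdf 0 s x) <= q * normal_pdf 0 (s * q) x.
  move=> q0; rewrite normal_pdf_scale//.
  have -> : normal_pdf 0 s x + k q * (x ^+ 2 * normal_pdf 0 s x) =
    normal_pdf 0 s x * (1 + k q * x ^+ 2) by ring.
  by rewrite ler_wpM2l ?normal_pdf_ge0 ?expR_ge1Dx.
have intq q : 0 < q -> (\int[mu]_x (q * normal_pdf 0 (s * q) x)%:E = q%:E)%E.
  move=> q0; under eq_integral do rewrite EFinM.
  rewrite ge0_integralZl//.
  - by rewrite integral_normal_pdf mule1.
  - by move=> x _; rewrite lee_fin normal_pdf_ge0.
  - by rewrite lee_fin ltW.
have mq q : measurable_fun [set: BR] (fun x : BR => (q * normal_pdf 0 (s * q) x)%:E).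
  exact: (emeasurable_funM (measurable_cst q%:E) (mpdf (s * q))).
have mk t : measurable_fun [set: BR] (fun x : BR => (t * (x ^+ 2 * normal_pdf 0 s x))%:E).
  exact: (emeasurable_funM (measurable_cst t%:E) mint).
have intk t : 0 <= t ->
    (\int[mu]_x (t * (x ^+ 2 * normal_pdf 0 s x))%:E = t%:E * c)%E.
  move=> t0; under eq_integral do rewrite EFinM.
  by rewrite ge0_integralZl.
have up q : 1 < q -> (1 + (k q)%:E * c <= q%:E)%E.
  move=> q1; have q0 : 0 < q by apply: lt_trans q1.
  have kq : 0 <= k q.
    rewrite /k divr_ge0 ?mulrn_wge0 ?sqr_ge0// subr_ge0 invf_le1 ?exprn_gt0//.
    by rewrite exprn_ege1// ltW.
  have k_ge0 x : (0 <= (k q * (x ^+ 2 * normal_pdf 0 s x))%:E)%E.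
    by rewrite lee_fin mulr_ge0// mulr_ge0 ?sqr_ge0 ?normal_pdf_ge0.
  have p_ge0 x : (0 <= (normal_pdf 0 s x)%:E)%E.
    by rewrite lee_fin normal_pdf_ge0.
  have : (\int[mu]_x ((normal_pdf 0 s x)%:E +
      (k q * (x ^+ 2 * normal_pdf 0 s x))%:E) <=
      \int[mu]_x (q * normal_pdf 0 (s * q) x)%:E)%E.
    apply: ge0_le_integral => [|x _||| x _].
    - exact: measurableT.
    - exact: adde_ge0.
    - exact: emeasurable_funD.
    - exact: mq.
    - by rewrite -EFinD lee_fin pw.
  rewrite ge0_integralD; [|exact: measurableT|by move=> x _|exact: mpdf|by move=> x _|exact: mk].
  by rewrite integral_normal_pdf intk// intq.
have low q : 0 < q < 1 -> (1 <= q%:E + (- k q)%:E * c)%E.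
  move=> /andP[q0 q1].
  have kq : 0 <= - k q.
    rewrite /k -mulNr opprB divr_ge0 ?mulrn_wge0 ?sqr_ge0// subr_ge0.
    by rewrite invf_ge1 ?exprn_gt0// exprn_ile1// ltW.
  have q_ge0 x : (0 <= (q * normal_pdf 0 (s * q) x)%:E)%E.
    by rewrite lee_fin mulr_ge0 ?normal_pdf_ge0// ltW.
  have k_ge0 x : (0 <= (- k q * (x ^+ 2 * normal_pdf 0 s x))%:E)%E.
    by rewrite lee_fin mulr_ge0// mulr_ge0 ?sqr_ge0 ?normal_pdf_ge0.
  have : (\int[mu]_x (normal_pdf 0 s x)%:E <=
      \int[mu]_x ((q * normal_pdf 0 (s * q) x)%:E +
        (- k q * (x ^+ 2 * normal_pdf 0 s x))%:E))%E.
    apply: ge0_le_integral => [|x _||| x _].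
    - exact: measurableT.
    - by rewrite lee_fin normal_pdf_ge0.
    - exact: mpdf.
    - exact: emeasurable_funD.
    - by rewrite -EFinD lee_fin; have := pw q x q0; lra.
  rewrite ge0_integralD; [|exact: measurableT|by move=> x _|exact: mq|by move=> x _|exact: mk].
  by rewrite integral_normal_pdf intk// intq.
have s2 : 0 < s ^+ 2 by rewrite exprn_gt0.
have c_fin : c \is a fin_num.
  (* Since [k 2] is positive, the upper bracket at [q = 2] excludes an infinite second moment. *)
  rewrite ge0_fin_numE//; have := up 2 (ltr1n _ _ : (1 < 2 :> R)).
  have k2 : 0 < k 2 by rewrite /k divr_gt0// ?mulrn_wgt0//; lra.
  move: c_ge0; case: (c) => [c0| |] //= _; first by rewrite ltry.
  by rewrite gt0_muley ?lte_fin.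
rewrite -(fineK c_fin); congr (_%:E); set r := fine c.
have upr q : 1 < q -> 1 + k q * r <= q.
  by move=> /up; rewrite -(fineK c_fin) -EFinM -EFinD lee_fin.
have lowr q : 0 < q < 1 -> 1 <= q - k q * r.
  by move=> /low; rewrite -(fineK c_fin) -EFinM -EFinD lee_fin mulNr.
apply/eqP; rewrite eq_le; apply/andP; split; rewrite leNgt; apply/negP => rs.
(* Instead of a limit, one value of [q] suffices. With [e] a quarter of the relative excess of [r]
   over $s^2$, the bracket at [q = 1 + e] would give $(2+e)(1+4e) \le 2(1+e)^2$, which is false for
   positive [e]. A relative deficit is excluded in the same way by [q = 1 - e]. *)
- pose e := (r / s ^+ 2 - 1) / 4.
  have e0 : 0 < e by rewrite divr_gt0// subr_gt0 ltr_pdivlMr// mul1r.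
  have rE : r = s ^+ 2 * (1 + 4 * e).
    by rewrite /e; field; rewrite !gt_eqF.
  have := upr (1 + e); rewrite ltrDl e0 => /(_ isT).
  have -> : 1 + k (1 + e) * r = 1 + e * (2 + e) * (1 + 4 * e) / (2 * (1 + e) ^+ 2).
    by rewrite rE /k; field; rewrite !gt_eqF//; nra.
  rewrite lerD2l ler_pdivrMr; last by nra.
  by nra.
- pose e := (1 - r / s ^+ 2) / 4.
  have r0 : 0 <= r by rewrite fine_ge0.
  have e0 : 0 < e by rewrite divr_gt0// subr_gt0 ltr_pdivrMr// mul1r.
  have e1 : e <= 1 / 4.
    by rewrite /e ler_pM2r// gerBl divr_ge0// ltW.
  have rE : r = s ^+ 2 * (1 - 4 * e).
    by rewrite /e; field; rewrite !gt_eqF.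
  have := lowr (1 - e); rewrite subr_gt0 gtrBl e0 andbT.
  have -> : (e < 1) by lra.
  move=> /(_ isT).
  have -> : k (1 - e) * r = - (e * (2 - e) * (1 - 4 * e) / (2 * (1 - e) ^+ 2)).
    by rewrite rE /k; field; rewrite !gt_eqF//; lra.
  rewrite opprK -subr_ge0.
  have -> : 1 - e + e * (2 - e) * (1 - 4 * e) / (2 * (1 - e) ^+ 2) - 1 =
     (e * (2 - e) * (1 - 4 * e) - 2 * e * (1 - e) ^+ 2) / (2 * (1 - e) ^+ 2).
    by field; rewrite !gt_eqF//; lra.
  rewrite pmulr_lge0; last by rewrite invr_gt0; nra.
  nra.
Qed.
End affine.

(** Bayes' formula: if $t \sim \mathcal N(0,s^2)$ and, given $t$, $x \sim \mathcal N(t,a^2)$, the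
    joint density is also the marginal density of $x$ times the conditional density of $t$ given
    $x$. *)
Lemma normal_pdf_mix (R : realType) (a s t x : R) (c := Num.sqrt (a ^+ 2 + s ^+ 2)) :
  0 < a -> 0 < s ->
  normal_pdf t a x * normal_pdf 0 s t =
  normal_pdf 0 c x * normal_pdf (s ^+ 2 / c ^+ 2 * x) (s * a / c) t.
Proof.
move=> a0 s0.
have c2 : c ^+ 2 = a ^+ 2 + s ^+ 2.
  by rewrite sqr_sqrtr// addr_ge0// sqr_ge0.
have c0 : 0 < c by rewrite sqrtr_gt0 addr_gt0// exprn_gt0.
have an : a != 0 by rewrite gt_eqF.
have sn : s != 0 by rewrite gt_eqF.
have cn : c != 0 by rewrite gt_eqF.
have k0 : s * a / c != 0 by rewrite !mulf_neq0 ?invr_eq0.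
rewrite !normal_pdfE// mulrACA [RHS]mulrACA; congr (_ * _).
- rewrite /normal_peak -!invfM; congr (_^-1).
  rewrite -!sqrtrM ?mulrn_wge0 ?mulr_ge0 ?sqr_ge0 ?pi_ge0 ?invr_ge0 ?(ltW a0) ?(ltW c0)//.
  by congr Num.sqrt; field.
- rewrite /normal_fun -!expRD; congr expR.
  have -> : a ^+ 2 = c ^+ 2 - s ^+ 2 by rewrite c2 addrK.
  rewrite !exprMn exprVn.
  have -> : a ^+ 2 = c ^+ 2 - s ^+ 2 by rewrite c2 addrK.
  have h : c ^+ 2 - s ^+ 2 != 0 by rewrite c2 addrK expf_neq0.
  by field; rewrite cn sn h.
Qed.

(** * Convolution of one-dimensional Gaussians *)

Section mix.
Variable R : realType.
Notation mu := (@lebesgue_measure R).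
Local Notation BR := (measurableTypeR R).

Lemma normal_probE (m s : R) (A : set BR) :
  normal_prob m s A = (\int[mu]_x (normal_pdf m s x * \1_A x)%:E)%E.
Proof.
rewrite /normal_prob integral_mkcond; apply: eq_integral => x _.
by rewrite patchE indicE; case: ifPn => _; rewrite ?mulr1 ?mulr0.
Qed.

Lemma measurable_normal_kernel (a : R) (A : set BR) : 0 < a -> measurable A ->
  measurable_fun [set: BR * BR]
    (fun z : BR * BR => (normal_pdf z.1 a z.2 * \1_A z.2)%:E).
Proof.
move=> a0 mA.
have : measurable_fun [set: BR * BR] (fun z : BR * BR =>
    ((normal_pdf 0 a (z.2 - z.1))%:E * (\1_A z.2)%:E)%E).
  apply: emeasurable_funM.
    apply: (measurableT_comp (measurable_EFin_normal_pdf 0 a)) => //.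
    exact: measurable_funB.
  apply/measurable_EFinP; apply: (measurableT_comp (measurable_indic mA)).
  exact: measurable_snd.
(* The density depends on mean and argument only through their difference, which makes it jointly
   measurable. *)
congr (measurable_fun _ _); apply/funext => z; rewrite -EFinM.
by rewrite !normal_pdfE ?gt_eqF// [in RHS]normal_fun_center.
Qed.

Lemma measurable_normal_prob (a : R) (A : set BR) : 0 < a -> measurable A ->
  measurable_fun [set: BR] (fun t : BR => normal_prob t a A).
Proof.
move=> a0 mA.
have F_ge0 (z : BR * BR) : (0 <= (normal_pdf z.1 a z.2 * \1_A z.2)%:E)%E.
  by rewrite lee_fin mulr_ge0 ?normal_pdf_ge0// indicE.
have := measurable_fun_fubini_tonelli_F (m2 := mu) _ (measurable_normal_kernel a0 mA) F_ge0.
congr (measurable_fun _ _); apply/funext => t; rewrite /fubini_F /=.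
by rewrite normal_probE.
Qed.

(** After exchanging the integrals, Bayes' formula isolates the conditional density of [t], whose
    integral is 1. *)
Lemma normal_prob_mix (a s : R) (A : set BR) : 0 < a -> 0 < s -> measurable A ->
  (\int[normal_prob 0 s]_t normal_prob t a A =
   normal_prob 0 (Num.sqrt (a ^+ 2 + s ^+ 2)) A)%E.
Proof.
move=> a0 s0 mA.
pose F (z : BR * BR) := (normal_pdf z.1 a z.2 * \1_A z.2)%:E.
pose G (z : BR * BR) := (normal_pdf 0 s z.1)%:E.
have mF : measurable_fun [set: BR * BR] F by exact: measurable_normal_kernel.
have mG : measurable_fun [set: BR * BR] G.
  apply: (measurableT_comp (measurable_EFin_normal_pdf 0 s)).
  exact: measurable_fst.
have F_ge0 z : (0 <= F z)%E.
  by rewrite lee_fin mulr_ge0 ?normal_pdf_ge0// indicE.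
have G_ge0 z : (0 <= G z)%E by rewrite lee_fin normal_pdf_ge0.
have mN := measurable_normal_prob a0 mA.
rewrite ge0_integral_normal_prob//.
transitivity (\int[mu]_t \int[mu]_x ((F \* G)%E (t, x)))%E.
  apply: eq_integral => t _; rewrite normal_probE -ge0_integralZr//=.
  - exact: (measurableT_comp mF (pair1_measurable t)).
  - by move=> x _; exact: F_ge0 (t, x).
  - exact: G_ge0 (t, 0).
rewrite (fubini_tonelli (fun z => (F z * G z)%E)); last 2 first.
- exact: emeasurable_funM.
- by move=> z; rewrite mule_ge0.
rewrite normal_probE; apply: eq_integral => x _ /=.
under eq_integral => t _.
  rewrite /F /G /= -EFinM mulrAC normal_pdf_mix// mulrAC EFinM.
  over.
rewrite ge0_integralZl//.
- by rewrite integral_normal_pdf mule1.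
- exact: measurable_EFin_normal_pdf.
- by move=> t _; rewrite lee_fin normal_pdf_ge0.
- by rewrite lee_fin mulr_ge0 ?normal_pdf_ge0// indicE.
Qed.

End mix.

(** * Optimal transport between Gaussian measures *)

Lemma pushforward_probability d1 d2 (T1 : measurableType d1)
    (T2 : measurableType d2) (R : realType) (P : probability T1 R) (f : T1 -> T2) :
  measurable_fun [set: T1] f ->
  exists Q : probability T2 R, forall A, Q A = P (f @^-1` A).
Proof.
move=> mf; exists (distribution P (mfun_Sub (mem_set mf))) => A.
by [].
Qed.

(** * Existence of a standard Gaussian vector *)

Section gauss_tuple.
Variable R : realType.
Local Notation BR := (measurableTypeR R).

Definition dot n (w : 'rV[R]_n) (x : n.-tuple BR) : BR :=
  \sum_(i < n) w 0 i * tnth x i.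

Lemma measurable_dot n (w : 'rV[R]_n) : measurable_fun [set: n.-tuple BR] (dot w).
Proof.
have : measurable_fun [set: n.-tuple BR] (fun x : n.-tuple BR => \sum_(i < n) w 0 i * tnth x i : R).
  apply: measurable_sum => i; apply: measurable_funM => //.
  exact: measurable_tnth.
exact.
Qed.

Lemma is_gaussianE n (S : 'M[R]_n) (mu : set (n.-tuple BR) -> \bar R) (w : 'rV[R]_n) (A : set BR) :
  is_gaussian S mu -> w != 0 -> measurable A ->
  mu (dot w @^-1` A) = normal_prob 0 (Num.sqrt ((w *m S *m w^T) 0 0)) A.
Proof. by move=> g w0 mA; exact: g. Qed.

(** Adjoins an independent standard coordinate to a vector of size [n]. A linear functional of the
    result is $a x + w' \cdot y$, whose law is a convolution of two centered Gaussians. In dimension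
    0 there is no nonzero functional to check. *)
Lemma std_gaussian_exists n :
  exists p : probability (n.-tuple BR) R, is_gaussian (1%:M : 'M[R]_n) p.
Proof.
elim: n => [|n [p gp]].
  exists (\d_ ([tuple] : 0.-tuple BR)) => u.
  by move=> /eqP[]; apply/rowP => -[].
pose f (z : n.-tuple BR * BR) : n.+1.-tuple BR := [tuple of z.2 :: z.1].
have mf : measurable_fun [set: n.-tuple BR * BR] f.
  by apply: measurable_cons; [exact: measurable_snd|exact: measurable_fst].
have [q qE] := pushforward_probability (p \x (normal_prob 0 1 : probability BR R))%E mf.
exists q => w w0 A mA.
rewrite mulmx1 qE.
pose a := w 0 ord0; pose w' : 'rV[R]_n := \row_i w 0 (lift ord0 i).
have dE z : dot w (f z) = a * z.2 + dot w' z.1.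
  rewrite /dot big_ord_recl /=; congr (_ + _).
  by apply: eq_bigr => i _; rewrite mxE tnthS.
have nE : (w *m w^T) 0 0 = a ^+ 2 + (w' *m w'^T) 0 0.
  rewrite !mxE big_ord_recl !mxE; congr (_ + _).
  by apply: eq_bigr => i _; rewrite !mxE.
have mp := measurable_dot w'.
transitivity
   (\int[p]_y normal_prob 0 1 ((fun x : BR => (a * x + dot w' y)%R) @^-1` A))%E.
  apply: eq_integral => y _ /=; congr (normal_prob 0 1 _).
  apply/seteqP; split => x; rewrite xsectionP /=.
    by rewrite -[X in A X]/(dot w (f (y, x))) dE.
  by rewrite -[X in _ -> A X]/(dot w (f (y, x))) dE.
(* The convolution formula requires two positive deviations, because [normal_prob] with deviation 0
   is not a Dirac mass; hence [a = 0], and later [w' = 0], are treated apart. *)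
have [a0|a0] := eqVneq a 0.
  have w'0 : w' != 0.
    apply: contra w0 => /eqP w'0; rewrite -sqnorm_eq0 nE a0 w'0 mul0mx mxE.
    by rewrite expr0n addr0.
  have mA' : measurable (dot w' @^-1` A).
    by rewrite -[X in measurable X]setTI; exact: mp.
  transitivity (\int[p]_y (\1_(dot w' @^-1` A) y)%:E)%E.
    apply: eq_integral => y _; rewrite indicE a0.
    have [yA|yA] := boolP (y \in _).
      rewrite [X in normal_prob _ _ X](_ : _ = setT) ?probability_setT//.
      by apply/seteqP; split => // x _ /=; rewrite mul0r add0r; exact: set_mem yA.
    rewrite [X in normal_prob _ _ X](_ : _ = set0) ?measure0//.
    apply/seteqP; split => // x /=; rewrite mul0r add0r => Ax.
    by move/negP: yA; apply; exact: mem_set.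
  rewrite integral_indic// setIT.
  apply: (eq_trans (is_gaussianE gp w'0 mA)).
  by rewrite mulmx1 nE a0 expr0n add0r.
have na0 : 0 < `|a| by rewrite normr_gt0.
under eq_integral do rewrite -normal_prob_affine// ?oner_neq0// mulr1.
have [w'0|w'0] := eqVneq w' 0.
  rewrite (eq_integral (cst (normal_prob 0 `|a| A))); last first.
    move=> y _; rewrite /dot w'0 big1// => i _.
    by rewrite mxE mul0r.
  transitivity (normal_prob 0 `|a| A * 1)%E.
    by rewrite integral_cst//; congr (_ * _)%E; exact: probability_setT.
  rewrite mule1 nE w'0 mul0mx mxE addr0.
  by rewrite sqrtr_sqr.
transitivity (\int[pushforward p (dot w')]_t normal_prob t `|a| A)%E.
  by rewrite ge0_integral_pushforward//; exact: measurable_normal_prob.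
have s0 : 0 < (w' *m w'^T) 0 0 by rewrite lt_def sqnorm_eq0 w'0 sqnorm_ge0.
transitivity (\int[normal_prob 0 (Num.sqrt ((w' *m w'^T) 0 0))%R]_t normal_prob t `|a| A)%E.
  apply: eq_measure_integral => B mB _.
  by have := is_gaussianE gp w'0 mB; rewrite mulmx1.
have ss0 : 0 < Num.sqrt ((w' *m w'^T) 0 0) by rewrite sqrtr_gt0.
apply: (eq_trans (normal_prob_mix na0 ss0 mA)).
congr (normal_prob 0 (Num.sqrt _) A).
by rewrite nE real_normK ?num_real// sqr_sqrtr// ltW.
Qed.

End gauss_tuple.

(** * Couplings and the value of the Wasserstein distance *)

Section coupling.
Variables (R : realType) (n : nat).
Local Notation BR := (measurableTypeR R).
Local Notation BT := (n.-tuple BR).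
Implicit Types (S A B M N : 'M[R]_n) (w : 'rV[R]_n) (x y : BT).

Definition row_of x : 'rV[R]_n := \row_i tnth x i.

(** This is $|Ax|^2$, written as a sum of squared linear functionals so that its Gaussian
    expectation reduces to one-dimensional second moments. *)
Definition sqn m (A : 'M[R]_(m, n)) x : R := \sum_i dot (row i A) x ^+ 2.

Lemma dotE w x : dot w x = (row_of x *m w^T) 0 0.
Proof. by rewrite mxE; apply: eq_bigr => i _; rewrite !mxE mulrC. Qed.

Lemma sqnE m (A : 'M[R]_(m, n)) x :
  sqn A x = ((row_of x *m A^T) *m (row_of x *m A^T)^T) 0 0.
Proof.
rewrite [RHS]mxE; apply: eq_bigr => i _; rewrite [_^T _ _]mxE -expr2 dotE.
by rewrite !mxE; congr (_ ^+ 2); apply: eq_bigr => j _; rewrite !mxE.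
Qed.

Lemma sqn_ge0 m (A : 'M[R]_(m, n)) x : 0 <= sqn A x.
Proof. by rewrite sumr_ge0// => i _; rewrite sqr_ge0. Qed.

Lemma measurable_sqn m (A : 'M[R]_(m, n)) :
  measurable_fun [set: BT] (fun x : BT => (sqn A x)%:E).
Proof.
have : measurable_fun [set: BT] (fun x : BT => sqn A x).
  by apply: measurable_sum => i; apply: measurable_funX; exact: measurable_dot.
by move=> /measurable_EFinP.
Qed.

Section law.
Context d (T : measurableType d) (P : probability T R) (X : T -> BT) (S : 'M[R]_n).
Hypotheses (mX : measurable_fun [set: T] X) (gX : is_gaussian S (pushforward P X)).
Hypothesis sS : spd S.

(** The vector [X] lives on an arbitrary probability space, so that the lemma applies to each
    marginal of a coupling. *)
Lemma gaussian_second_moment w :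
  (\int[P]_z (dot w (X z) ^+ 2)%:E = ((w *m S *m w^T) 0 0)%:E)%E.
Proof.
(* [is_gaussian] says nothing about the zero functional, which occurs when a matrix has a zero
   row. *)
have [->|w0] := eqVneq w 0.
  rewrite !mul0mx mxE integral0_eq// => z _.
  by rewrite /dot big1 ?expr0n// => i _; rewrite mxE mul0r.
have q0 : 0 < (w *m S *m w^T) 0 0 by exact: sS.2.
have mdX : measurable_fun [set: T] (fun z => dot w (X z)).
  exact: (measurableT_comp (measurable_dot w) mX).
have msq : measurable_fun [set: BR] (fun t : BR => (t ^+ 2)%:E).
  have : measurable_fun [set: R] (EFin \o (fun x : R => x ^+ 2)).
    by apply/measurable_EFinP; exact: measurable_funX.
  exact.
transitivity (\int[pushforward P (fun z => dot w (X z))]_t (t ^+ 2)%:E)%E.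
  by rewrite ge0_integral_pushforward// => t _; rewrite lee_fin sqr_ge0.
transitivity (\int[normal_prob 0 (Num.sqrt ((w *m S *m w^T) 0 0))%R]_t (t ^+ 2)%:E)%E.
  by apply: eq_measure_integral => B mB _; exact: gX.
by rewrite normal_second_moment ?sqrtr_gt0// sqr_sqrtr// ltW.
Qed.

Lemma gaussian_sqn m (A : 'M[R]_(m, n)) :
  (\int[P]_z (sqn A (X z))%:E = (\tr (A *m S *m A^T))%:E)%E.
Proof.
under eq_integral do rewrite -sumEFin.
rewrite ge0_integral_sum//.
- rewrite mxtrace_quad -sumEFin; apply: eq_bigr => i _.
  exact: gaussian_second_moment.
- move=> i; apply/measurable_EFinP; apply: measurable_funX.
  exact: (measurableT_comp (measurable_dot _) mX).
- by move=> i z _; rewrite lee_fin sqr_ge0.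
Qed.

End law.

Lemma measurable_cost : measurable_fun [set: BT * BT]
  (fun z : BT * BT => (\sum_(i < n) (tnth z.1 i - tnth z.2 i) ^+ 2)%:E).
Proof.
have : measurable_fun [set: BT * BT]
    (fun z : BT * BT => \sum_(i < n) (tnth z.1 i - tnth z.2 i) ^+ 2 : R).
  apply: measurable_sum => i; apply: measurable_funX.
  apply: measurable_funB.
    exact: (measurableT_comp (measurable_tnth i) measurable_fst).
  exact: (measurableT_comp (measurable_tnth i) measurable_snd).
by move=> /measurable_EFinP.
Qed.

Lemma costE x y : \sum_(i < n) (tnth x i - tnth y i) ^+ 2 =
  ((row_of x - row_of y) *m (row_of x - row_of y)^T) 0 0.
Proof. by rewrite mxE; apply: eq_bigr => i _; rewrite !mxE. Qed.

(* For [N] positive definite, the potentials [|u|^2 - |u N|^2] and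
   [|v|^2 - |v N^-1|^2] are admissible in the dual Kantorovich problem; they are
   optimal for the transport map [N *m N]. *)
Lemma young_quad (u v : 'rV[R]_n) N : N^T = N -> N \in unitmx ->
  (u *m u^T) 0 0 + (v *m v^T) 0 0 <=
  ((u - v) *m (u - v)^T) 0 0 + ((u *m N) *m (u *m N)^T) 0 0
   + ((v *m invmx N) *m (v *m invmx N)^T) 0 0.
Proof.
move=> Ns Nu; have := sqnorm_ge0 (u *m N - v *m invmx N).
have Is : (invmx N)^T = invmx N by rewrite trmx_inv Ns.
rewrite ![(_ - _)^T]linearB /= !mulmxBl !mulmxBr.
have E1 : (u *m N) *m (v *m invmx N)^T = u *m v^T.
  by rewrite trmx_mul Is -mulmxA mulKVmx.
have E2 : (v *m invmx N) *m (u *m N)^T = v *m u^T.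
  by rewrite trmx_mul Ns -mulmxA mulKmx.
rewrite E1 E2; move: (_ *m _^T) (_ *m _^T) (u *m u^T) (v *m v^T) (u *m v^T) (v *m u^T).
by move=> a b c e f g; rewrite !mxE; lra.
Qed.

(** All terms of the pointwise inequality are kept additive and nonnegative, so it can be integrated
    even when the cost is infinite. Both correction terms integrate to $\operatorname{Tr}(MS)$,
    since $N^{-1}(MSM)N^{-1} = NSN$. *)
Lemma transport_cost_ge S M (p : probability (BT * BT)%type R) :
  spd S -> spd M -> gaussian_coupling S (M *m S *m M) p ->
  ((bw_inner S (M - 1%:M) (M - 1%:M))%:E <= transport_cost p)%E.
Proof.
move=> sS sM [g1 g2]; have [N sN NN] := spd_sqrt sM.
have Ms : M^T = M := sM.1; have Ns : N^T = N := sN.1.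
have Nu := spd_unit sN; have Mu := spd_unit sM.
have sMSM : spd (M *m S *m M) by rewrite -{2}Ms; exact: spd_congr.
have Is : (invmx N)^T = invmx N by rewrite trmx_inv Ns.
have m1 : measurable_fun [set: BT * BT] (@fst BT BT) by exact: measurable_fst.
have m2 : measurable_fun [set: BT * BT] (@snd BT BT) by exact: measurable_snd.
have I1 A := gaussian_sqn m1 g1 sS A.
have I2 A := gaussian_sqn m2 g2 sMSM A.
have mq1 A : measurable_fun [set: BT * BT] (fun z : BT * BT => (sqn A z.1)%:E).
  exact: (measurableT_comp (measurable_sqn A) m1).
have mq2 A : measurable_fun [set: BT * BT] (fun z : BT * BT => (sqn A z.2)%:E).
  exact: (measurableT_comp (measurable_sqn A) m2).
have q1 A (z : BT * BT) : (0 <= (sqn A z.1)%:E)%E by rewrite lee_fin sqn_ge0.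
have q2 A (z : BT * BT) : (0 <= (sqn A z.2)%:E)%E by rewrite lee_fin sqn_ge0.
have mc := measurable_cost.
have c0 (z : BT * BT) : (0 <= (\sum_(i < n) (tnth z.1 i - tnth z.2 i) ^+ 2)%:E)%E.
  by rewrite lee_fin sumr_ge0// => i _; rewrite sqr_ge0.
have : (\int[p]_z ((sqn 1%:M z.1)%:E + (sqn 1%:M z.2)%:E) <=
  \int[p]_z ((\sum_(i < n) (tnth z.1 i - tnth z.2 i) ^+ 2)%:E + (sqn N z.1)%:E
      + (sqn (invmx N) z.2)%:E))%E.
  apply: ge0_le_integral => [|z _||| z _].
  - exact: measurableT.
  - exact: adde_ge0.
  - exact: emeasurable_funD.
  - by apply: emeasurable_funD => //; exact: emeasurable_funD.
  - rewrite -!EFinD lee_fin !sqnE trmx1 !mulmx1 Ns Is costE.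
    exact: young_quad.
rewrite ge0_integralD; [|exact: measurableT|by move=> z _|by []|by move=> z _|by []].
rewrite ge0_integralD; first last.
- exact: mq2.
- by move=> z _.
- exact: emeasurable_funD.
- by move=> z _; exact: adde_ge0.
- exact: measurableT.
rewrite ge0_integralD; [|exact: measurableT|by move=> z _|by []|by move=> z _|by []].
rewrite !I1 !I2 -/(transport_cost p) !trmx1 !mulmx1 !mul1mx Ns Is.
have -> : N *m S *m N = N *m (S *m N) by rewrite mulmxA.
have -> : invmx N *m (M *m S *m M) *m invmx N = N *m (S *m N).
  by rewrite -NN !mulmxA mulVmx// mul1mx -!mulmxA mulmxV// mulmx1.
have -> : \tr (N *m (S *m N)) = \tr (M *m S).
  by rewrite mxtrace_mulC -mulmxA NN mxtrace_mulC.
have -> : bw_inner S (M - 1%:M) (M - 1%:M) =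
    \tr S + \tr (M *m S *m M) - \tr (M *m S) - \tr (M *m S).
  rewrite /bw_inner mulmxBl mul1mx mulmxBr mulmx1 mulmxBl.
  have tB (X Y : 'M[R]_n) : \tr (X - Y) = \tr X - \tr Y by exact: raddfB.
  by rewrite !tB (mxtrace_mulC S M); ring.
case: (transport_cost p) => [c| |] h //; last by rewrite leey.
by move: h; rewrite -!EFinD !lee_fin; lra.
Qed.

Definition lin A x : BT := [tuple dot (row i A) x | i < n].

Lemma measurable_lin A : measurable_fun [set: BT] (lin A).
Proof.
apply/measurable_fun_tnthP => i.
rewrite (_ : _ \o _ = dot (row i A)); first exact: measurable_dot.
by apply/funext => x /=; rewrite tnth_mktuple.
Qed.

Lemma dot_lin w A x : dot w (lin A x) = dot (w *m A) x.
Proof.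
rewrite !dotE trmx_mul mulmxA; congr ((_ *m _) 0 0).
apply/rowP => i; rewrite !mxE tnth_mktuple.
by apply: eq_bigr => j _; rewrite !mxE mulrC.
Qed.

Lemma is_gaussian_lin (g : probability BT R) A : A \in unitmx ->
  is_gaussian (1%:M : 'M[R]_n) g ->
  is_gaussian (A *m A^T) (pushforward g (lin A)).
Proof.
move=> Au gg w w0 B mB.
have wA0 : w *m A != 0.
  by apply: contra w0 => /eqP wA; rewrite -[w](mulmxK Au) wA mul0mx.
have := is_gaussianE gg wA0 mB; rewrite mulmx1 trmx_mul !mulmxA => <-.
rewrite /pushforward; congr (g _); apply/funext => x; congr (B _).
exact: dot_lin.
Qed.

(** Both marginals are driven by one standard Gaussian vector $x$, as $(Ax, Bx)$; the cost is the
    expectation of $|(A-B)x|^2$. *)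
Lemma coupling_exists A B : A \in unitmx -> B \in unitmx ->
  exists p : probability (BT * BT)%type R,
    gaussian_coupling (A *m A^T) (B *m B^T) p /\ transport_cost p = (\tr ((A - B) *m (A - B)^T))%:E.
Proof.
move=> Au Bu; have [g gg] := std_gaussian_exists R n.
pose f x := (lin A x, lin B x).
have mf : measurable_fun [set: BT] f.
  by apply/measurable_fun_pair => /=; exact: measurable_lin.
have [p pE] := pushforward_probability g mf.
exists p; split.
  split=> w w0 C mC.
    by have := is_gaussian_lin Au gg w0 mC; rewrite /pushforward pE.
  by have := is_gaussian_lin Bu gg w0 mC; rewrite /pushforward pE.
rewrite /transport_cost (eq_measure_integral (pushforward g f)); last first.
  by move=> C mC _; exact: pE.
rewrite ge0_integral_pushforward//; last first.
- by move=> z _; rewrite lee_fin sumr_ge0// => i _; rewrite sqr_ge0.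
- exact: measurable_cost.
have s1 : spd (1%:M : 'M[R]_n).
  split; first exact: trmx1.
  by move=> u u0; rewrite mulmx1 lt_def sqnorm_eq0 u0 sqnorm_ge0.
transitivity (\int[g]_x (sqn (A - B) (id x))%:E)%E.
  apply: eq_integral => x _ /=; congr (_%:E); apply: eq_bigr => i _.
  rewrite !tnth_mktuple; congr (_ ^+ 2).
  by rewrite !dotE linearB /= linearB /= mulmxBr !mxE.
by rewrite (gaussian_sqn (S := 1%:M))// mulmx1.
Qed.

Lemma W2_transport S M : spd S -> spd M ->
  W2 S (M *m S *m M) = bw_norm S (M - 1%:M).
Proof.
move=> sS sM; rewrite /W2 /bw_norm; congr Num.sqrt.
have [A sA AA] := spd_sqrt sS.
have As : A^T = A := sA.1; have Ms : M^T = M := sM.1.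
have MAu : M *m A \in unitmx by rewrite unitmx_mul !spd_unit.
(* The factors $A$ and $MA$ realize the deterministic coupling $y = Mx$, which attains the lower
   bound. *)
have [p [pc pE]] := coupling_exists (spd_unit sA) MAu.
rewrite (_ : ereal_inf _ = (bw_inner S (M - 1%:M) (M - 1%:M))%:E)//.
apply/eqP; rewrite eq_le; apply/andP; split.
  apply: ereal_inf_lbound; exists p.
    by move: pc; rewrite /= trmx_mul As Ms AA !mulmxA -(mulmxA M A A) AA.
  rewrite pE; congr (_%:E).
  have -> : A - M *m A = - ((M - 1%:M) *m A) by rewrite mulmxBl mul1mx opprB.
  rewrite [(- _)^T]linearN /= mulmxN mulNmx opprK trmx_mul As.
  by rewrite [(_ - _)^T]linearB /= Ms trmx1 -AA /bw_inner !mulmxA.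
apply: le_ereal_inf_tmp => _ [q qc <-]; exact: transport_cost_ge.
Qed.

End coupling.

(** * Curvature of the Bures-Wasserstein metric *)

Section trace_words.
Variables (R : realType) (n : nat).
Implicit Types A B C D E : 'M[R]_n.

Lemma mxtraceN A : \tr (- A) = - \tr A.
Proof. exact: raddfN. Qed.

Lemma mxtrace_rot4 A B C D : \tr (A *m B *m C *m D) = \tr (D *m A *m B *m C).
Proof. by rewrite mxtrace_mulC !mulmxA. Qed.

Lemma mxtrace_rot5 A B C D E :
  \tr (A *m B *m C *m D *m E) = \tr (E *m A *m B *m C *m D).
Proof. by rewrite mxtrace_mulC !mulmxA. Qed.

Lemma mxtrace_rev4 A B C D : A^T = A -> B^T = B -> C^T = C -> D^T = D ->
  \tr (A *m B *m C *m D) = \tr (D *m C *m B *m A).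
Proof.
move=> As Bs Cs Ds; rewrite -[LHS]mxtrace_tr !trmx_mul As Bs Cs Ds.
by rewrite !mulmxA.
Qed.

Lemma mxtrace_rev5 A B C D E :
  A^T = A -> B^T = B -> C^T = C -> D^T = D -> E^T = E ->
  \tr (A *m B *m C *m D *m E) = \tr (E *m D *m C *m B *m A).
Proof.
move=> As Bs Cs Ds Es; rewrite -[LHS]mxtrace_tr !trmx_mul As Bs Cs Ds Es.
by rewrite !mulmxA.
Qed.

End trace_words.

Ltac same4 := match goal with
  |- \tr (?a *m ?b *m ?c *m ?d) = \tr (?a *m ?b *m ?c *m ?d) => reflexivity end.
Ltac same5 := match goal with
  |- \tr (?a *m ?b *m ?c *m ?d *m ?e) = \tr (?a *m ?b *m ?c *m ?d *m ?e) =>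
    reflexivity end.
Ltac rotate4 := first [same4
  | do 1 rewrite [LHS]mxtrace_rot4; same4 | do 2 rewrite [LHS]mxtrace_rot4; same4
  | do 3 rewrite [LHS]mxtrace_rot4; same4].
Ltac rotate5 := first [same5
  | do 1 rewrite [LHS]mxtrace_rot5; same5 | do 2 rewrite [LHS]mxtrace_rot5; same5
  | do 3 rewrite [LHS]mxtrace_rot5; same5 | do 4 rewrite [LHS]mxtrace_rot5; same5].
(* Equality of traces of words in symmetric matrices up to rotation and reversal. *)
Ltac word4 := first [rotate4 | rewrite [LHS]mxtrace_rev4 //; rotate4].
Ltac word5 := first [rotate5 | rewrite [LHS]mxtrace_rev5 //; rotate5].

(** Rewrites to [w] every four-letter trace that agrees with it up to rotation and reversal. Once
    all classes are collected, a trace identity is linear in independent atoms and falls to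
    [lra]. *)
Ltac collect4 w := repeat match goal with
  |- context [\tr (?a *m ?b *m ?c *m ?d)] => lazymatch constr:(\tr (a *m b *m c *m d)) with
     | w => fail
     | _ => rewrite (_ : \tr (a *m b *m c *m d) = w); [|by word4] end end.
Ltac collect5 w := repeat match goal with
  |- context [\tr (?a *m ?b *m ?c *m ?d *m ?e)] =>
     lazymatch constr:(\tr (a *m b *m c *m d *m e)) with
     | w => fail
     | _ => rewrite (_ : \tr (a *m b *m c *m d *m e) = w); [|by word5] end end.

(** * The Lyapunov operator and the metric in the chart *)

Section lyapunov.
Variables (R : realType) (n : nat).
Implicit Types S U V W X Y Z : 'M[R]_n.

(** The operator [velocity S] on all matrices, as a matrix acting on vectorized arguments; its
    inverse is then accessible through determinants and cofactors. *)
Definition velocity_mx S : 'M[R]_(n * n) := lin_mulmx S + lin_mulmxr S.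

Lemma mul_velocity_mx S V : mxvec V *m velocity_mx S = mxvec (velocity S V).
Proof. by rewrite mulmxDr !mul_vec_lin /= -linearD. Qed.

(* The inverse of [velocity S]; unlike [of_velocity], it is given by a rational
   expression in the entries of [S]. *)
Definition lyap S X : 'M[R]_n := vec_mx (mxvec X *m invmx (velocity_mx S)).

(** The domain on which the chart formulas hold. It is stable under small symmetric perturbations by
    continuity of a determinant, so identities on it can be differentiated. *)
Definition regular S := S^T = S /\ velocity_mx S \in unitmx.

(** If $SV+VS=0$ and $N^2=S$, the trace against $V^T$ gives $\|V^TN\|_F^2+\|VN\|_F^2=0$. Here [V]
    ranges over all matrices, since [velocity_mx] acts on all of them. *)
Lemma spd_regular S : spd S -> regular S.
Proof.
move=> sS; split; first exact: sS.1.
rewrite -row_free_unit; apply: inj_row_free => v.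
rewrite -[v]vec_mxK mul_velocity_mx => /eqP; rewrite mxvec_eq0 => /eqP.
move: (vec_mx v) => V V0; apply/eqP; rewrite mxvec_eq0; apply/eqP.
have [N sN NN] := spd_sqrt sS; have Ns : N^T = N := sN.1.
have h1 : \tr (V^T *m S *m V) = \tr ((V^T *m N) *m (V^T *m N)^T).
  by rewrite trmx_mul trmxK Ns -NN !mulmxA.
have h2 : \tr (V *m S *m V^T) = \tr ((V *m N) *m (V *m N)^T).
  by rewrite trmx_mul Ns -NN !mulmxA.
have : \tr (V^T *m velocity S V) = 0 by rewrite V0 mulmx0 mxtrace0.
rewrite mulmxDr mxtraceD mulmxA h1 mulmxA (mxtrace_mulC _ S) mulmxA.
rewrite (mxtrace_mulC _ V) mulmxA h2 => h.
have N0 := mxtrace_sqr_ge0 (V *m N); have N1 := mxtrace_sqr_ge0 (V^T *m N).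
have : \tr ((V *m N) *m (V *m N)^T) = 0 by lra.
move=> /mxtrace_sqr_eq0 VN; have Nu := spd_unit sN.
by rewrite -[V](mulmxK Nu) VN mul0mx.
Qed.

Section regular.
Variable S : 'M[R]_n.
Hypothesis rS : regular S.

Lemma velocityK X : velocity S (lyap S X) = X.
Proof.
apply: (can_inj mxvecK); rewrite -mul_velocity_mx /lyap vec_mxK mulmxKV//.
exact: rS.2.
Qed.

Lemma lyapK V : lyap S (velocity S V) = V.
Proof. by rewrite /lyap -mul_velocity_mx mulmxK ?mxvecK//; exact: rS.2. Qed.

Lemma lyapD X Y : lyap S (X + Y) = lyap S X + lyap S Y.
Proof. by rewrite /lyap linearD mulmxDl linearD. Qed.

Lemma lyapN X : lyap S (- X) = - lyap S X.
Proof. by rewrite /lyap linearN mulNmx linearN. Qed.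

Lemma lyap_sym X : X^T = X -> (lyap S X)^T = lyap S X.
Proof.
move=> Xs; rewrite -[LHS]lyapK; congr (lyap S _).
rewrite -[RHS]Xs -[in RHS](velocityK X) /velocity [(_ + _)^T]linearD /= !trmx_mul.
by rewrite rS.1 addrC.
Qed.

Lemma of_velocityE X : X^T = X -> of_velocity S X = lyap S X.
Proof.
move=> Xs; apply: xget_unique => [|V [_ <-]]; last by rewrite lyapK.
by split; [exact: lyap_sym|exact: velocityK].
Qed.

Lemma mxtrace_lyap X Y : \tr (lyap S X *m Y) = \tr (X *m lyap S Y).
Proof.
rewrite -{1}(velocityK Y) -{2}(velocityK X) /velocity mulmxDr mulmxDl !mxtraceD.
rewrite addrC; congr (_ + _); last by rewrite mulmxA.
by rewrite mulmxA mxtrace_mulC mulmxA.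
Qed.

(** Expanding one velocity removes one of the two Lyapunov inverses, so that differentiating the
    metric means differentiating a single inverse. *)
Lemma bw_metricE X Y : X^T = X -> Y^T = Y ->
  2 * bw_metric S X Y = \tr (X *m lyap S Y).
Proof.
move=> Xs Ys; rewrite /bw_metric !of_velocityE// /bw_inner.
have Us := lyap_sym Xs; have Vs := lyap_sym Ys.
rewrite -[in RHS](velocityK X) /velocity mulmxDl mxtraceD.
move: (lyap S X) (lyap S Y) Us Vs => U V Us Vs.
have -> : \tr (S *m U *m V) = \tr (U *m S *m V).
  by rewrite -mxtrace_tr !trmx_mul Us Vs rS.1 mxtrace_mulC.
by ring.
Qed.

Lemma bw_metricE' X Y : X^T = X -> Y^T = Y ->
  bw_metric S X Y = 2^-1 * \tr (lyap S X *m Y).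
Proof.
move=> Xs Ys; rewrite mxtrace_lyap -bw_metricE//; by field.
Qed.

End regular.
End lyapunov.

(** * Differentiation along matrix curves *)

Section curve.
Variable R : realType.

(** Entrywise derivative at 0, the only point needed: a directional derivative at [S] is the
    derivative at 0 along $h \mapsto S + hX$. *)
Definition mx_is_derive m n (f : R -> 'M[R]_(m, n)) (df : 'M[R]_(m, n)) :=
  forall i j, is_derive (0 : R) (1 : R) (fun h => f h i j) (df i j).

Lemma derive_line (W : normedModType R) n (F : 'M[R]_n -> W) S X :
  'D_X F S = 'D_1 (fun h : R => F (S + h *: X)) 0.
Proof.
have E : (fun h : R => h^-1 *: ((F \o shift S) (h *: X) - F S)) =
    (fun h : R => h^-1 *: (((fun k : R => F (S + k *: X)) \o shift 0) (h *: 1)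
      - F (S + 0 *: X))).
  apply/funext => h /=.
  by rewrite -[h%:A]/(h * 1) mulr1 addr0 scale0r addr0 (addrC S).
by rewrite /derive E.
Qed.

Lemma mx_is_derive_derive m n (f : R -> 'M[R]_(m, n)) df :
  mx_is_derive f df -> 'D_1 f 0 = df.
Proof.
move=> fd; rewrite derive_mx; last first.
  by apply/derivable_mxP => i j; apply: ex_derive.
by apply/matrixP => i j; rewrite mxE; apply: derive_val.
Qed.

Lemma mx_is_derive_near m n (f g : R -> 'M[R]_(m, n)) df :
  (\forall h \near (0 : R), f h = g h) -> mx_is_derive g df -> mx_is_derive f df.
Proof.
move=> fg gd i j; have := gd i j.
apply: near_eq_is_derive.
by apply: filterS fg => h ->.
Qed.

Lemma mx_is_derive_cst m n (A : 'M[R]_(m, n)) : mx_is_derive (fun=> A) 0.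
Proof. by move=> i j; rewrite mxE; exact: is_derive_cst. Qed.

Lemma mx_is_deriveD m n (f g : R -> 'M[R]_(m, n)) df dg :
  mx_is_derive f df -> mx_is_derive g dg -> mx_is_derive (fun h => f h + g h) (df + dg).
Proof.
move=> fd gd i j; rewrite mxE.
rewrite (_ : (fun h => _) = (fun h => f h i j) \+ (fun h => g h i j)).
  exact: is_deriveD.
by apply/funext => h; rewrite mxE.
Qed.

Lemma mx_is_deriveN m n (f : R -> 'M[R]_(m, n)) df :
  mx_is_derive f df -> mx_is_derive (fun h => - f h) (- df).
Proof.
move=> fd i j; rewrite mxE.
rewrite (_ : (fun h => _) = \- (fun h => f h i j)).
  exact: is_deriveN.
by apply/funext => h; rewrite mxE.
Qed.

Lemma mx_is_deriveM m n p (f : R -> 'M[R]_(m, n)) (g : R -> 'M[R]_(n, p)) df dg :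
  mx_is_derive f df -> mx_is_derive g dg ->
  mx_is_derive (fun h => f h *m g h) (df *m g 0 + f 0 *m dg).
Proof.
move=> fd gd i j; rewrite !mxE -big_split /=.
rewrite (_ : (fun h => _) = \sum_(k < n) (fun h => f h i k * g h k j)).
  apply: is_derive_sum => k.
  refine (is_derive_eq (is_deriveM (fd i k) (gd k j)) _).
  by rewrite addrC; congr (_ + _); rewrite -[_ *: _]/(_ * _) mulrC.
by apply/funext => h; rewrite mxE fct_sumE.
Qed.

Lemma mx_is_derive_line n (S X : 'M[R]_n) : mx_is_derive (fun h => S + h *: X) X.
Proof.
move=> i j.
rewrite (_ : (fun h => _) = cst (S i j) \+ (fun h => X i j * h)).
  apply: is_derive_eq (is_deriveD _ _) _.
  by rewrite add0r -[_ *: _]/(_ * _) mulr1.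
by apply/funext => h; rewrite !mxE /= mulrC.
Qed.

Lemma mx_is_derive_trace n (f : R -> 'M[R]_n) df : mx_is_derive f df ->
  is_derive (0 : R) (1 : R) (fun h => \tr (f h)) (\tr df).
Proof.
move=> fd; rewrite (_ : (fun h => _) = \sum_(k < n) (fun h => f h k k)).
  by apply: is_derive_sum => k; exact: fd.
by apply/funext => h; rewrite fct_sumE.
Qed.

Lemma derivable_bigsum (V : normedModType R) (I : Type) (r : seq I) (P : pred I)
    (F : I -> V -> R) (x v : V) : (forall i, derivable (F i) x v) ->
  derivable (fun h => \sum_(i <- r | P i) F i h) x v.
Proof.
move=> Fd; elim: r => [|i r ih].
  by under eq_fun do rewrite big_nil; exact: derivable_cst.
under eq_fun do rewrite big_cons.
by case: (P i); [apply: derivableD; [exact: Fd|exact: ih]|exact: ih].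
Qed.

Lemma derivable_bigprod (V : normedModType R) (I : Type) (r : seq I) (P : pred I)
    (F : I -> V -> R) (x v : V) : (forall i, derivable (F i) x v) ->
  derivable (fun h => \prod_(i <- r | P i) F i h) x v.
Proof.
move=> Fd; elim: r => [|i r ih].
  by under eq_fun do rewrite big_nil; exact: derivable_cst.
under eq_fun do rewrite big_cons.
by case: (P i); [apply: derivableM; [exact: Fd|exact: ih]|exact: ih].
Qed.

Lemma derivable_det n (f : R -> 'M[R]_n) (x : R) :
  (forall i j, derivable (fun h => f h i j) x 1) ->
  derivable (fun h => \det (f h)) x 1.
Proof.
move=> fd; apply: derivable_bigsum => s; apply: derivableM.
  exact: derivable_cst.
by apply: derivable_bigprod => i; exact: fd.
Qed.

(** Cramer's rule: the determinant stays nonzero near 0, and there the inverse is the adjugate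
    divided by it, with determinants of minors as entries. *)
Lemma derivable_invmx n (f : R -> 'M[R]_n) :
  (forall i j, derivable (fun h => f h i j) (0 : R) 1) -> f 0 \in unitmx ->
  (\forall h \near (0 : R), f h \in unitmx) /\
  forall i j, derivable (fun h => invmx (f h) i j) (0 : R) 1.
Proof.
move=> fd f0; have dd := derivable_det fd.
have d0 : \det (f 0) != 0 by rewrite -unitfE -unitmxE.
have near_unit : \forall h \near (0 : R), f h \in unitmx.
  have dc : {for 0, continuous (fun h => \det (f h))}.
    by apply: differentiable_continuous; exact/derivable1_diffP.
  have : \forall h \near (0 : R), \det (f h) != 0.
    exact: (cvgr_neq0 _ dc d0).
  by apply: filterS => h; rewrite unitmxE unitfE.
split=> [|i j]; first exact: near_unit.
have : derivable (fun h => (\det (f h))^-1 * \adj (f h) i j) (0 : R) 1.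
  apply: derivableM; first exact: derivableV.
  rewrite (_ : (fun h => _) = fun h => cofactor (f h) j i); last first.
    by apply/funext => h; rewrite mxE.
  apply: derivableM; first exact: derivable_cst.
  apply: derivable_det => k l.
  rewrite (_ : (fun h => _) = fun h => f h (lift j k) (lift i l)); last first.
    by apply/funext => h; rewrite !mxE.
  exact: fd.
apply: near_eq_derivable.
by apply: filterS near_unit => h fu; rewrite /invmx fu !mxE.
Qed.

End curve.

(** * Christoffel symbols and curvature *)

Section lyap_derive.
Variables (R : realType) (n : nat).
Implicit Types S U V W X Y Z : 'M[R]_n.

Lemma velocity_mx_line S X (h : R) :
  velocity_mx (S + h *: X) = velocity_mx S + h *: velocity_mx X.
Proof.
rewrite /velocity_mx !linearD /= !linearZ /=.
by rewrite addrACA.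
Qed.

Lemma velocity_mx_derivable S X i j :
  derivable (fun h : R => velocity_mx (S + h *: X) i j) (0 : R) 1.
Proof.
rewrite (_ : (fun h => _) = fun h : R => (velocity_mx S + h *: velocity_mx X) i j).
  have := mx_is_derive_line (velocity_mx S) (velocity_mx X) i j.
  by move=> ?; exact: ex_derive.
by apply/funext => h; rewrite velocity_mx_line.
Qed.

Lemma regular_near S X : regular S -> X^T = X ->
  \forall h \near (0 : R), regular (S + h *: X).
Proof.
move=> [Ss Su] Xs.
have Su0 : velocity_mx (S + (0 : R) *: X) \in unitmx by rewrite scale0r addr0.
have [nu _] := derivable_invmx (@velocity_mx_derivable S X) Su0.
apply: filterS nu => h hu; split; last exact: hu.
by rewrite [(_ + _)^T]linearD /= linearZ /= Ss Xs.
Qed.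

(** Cramer's rule gives the existence of the derivative $L'$. Its value comes from differentiating
    the equation $(S+hX)L+L(S+hX)=Y$ at 0, which gives $SL'+L'S=-(XL+LX)$. *)
Lemma mx_is_derive_lyap S X Y : regular S -> X^T = X ->
  mx_is_derive (fun h : R => lyap (S + h *: X) Y)
    (- lyap S (X *m lyap S Y + lyap S Y *m X)).
Proof.
move=> rS Xs.
have ld i j : derivable (fun h : R => lyap (S + h *: X) Y i j) (0 : R) 1.
  have Su0 : velocity_mx (S + (0 : R) *: X) \in unitmx.
    by rewrite scale0r addr0; exact: rS.2.
  have [_ dinv] := derivable_invmx (@velocity_mx_derivable S X) Su0.
  rewrite (_ : (fun h => _) = fun h => \sum_k mxvec Y 0 k *
      invmx (velocity_mx (S + h *: X)) k (mxvec_index i j)).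
    apply: derivable_bigsum => k; apply: derivableM; last exact: dinv.
    exact: derivable_cst.
  by apply/funext => h; rewrite !mxE.
pose L' : 'M[R]_n := \matrix_(i, j) 'D_1 (fun h : R => lyap (S + h *: X) Y i j) (0 : R).
have Ld : mx_is_derive (fun h : R => lyap (S + h *: X) Y) L'.
  by move=> i j; rewrite mxE; exact: derivableP.
suff -> : - lyap S (X *m lyap S Y + lyap S Y *m X) = L' by [].
have dS := mx_is_derive_line S X.
have dY := mx_is_deriveD (mx_is_deriveM dS Ld) (mx_is_deriveM Ld dS).
have : mx_is_derive (fun h : R => velocity (S + h *: X) (lyap (S + h *: X) Y)) 0.
  apply: mx_is_derive_near (mx_is_derive_cst Y).
  by apply: filterS (regular_near rS Xs) => h rh; rewrite velocityK.
move=> /mx_is_derive_derive; rewrite (mx_is_derive_derive dY) scale0r addr0 => E.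
rewrite -[RHS](lyapK rS) -lyapN; congr (lyap S _); rewrite /velocity.
apply/eqP; rewrite eq_sym -subr_eq0 opprK -E; apply/eqP.
by rewrite addrACA [S *m _ + _]addrC.
Qed.

Lemma derive_metric S X Y Z : regular S -> X^T = X -> Y^T = Y -> Z^T = Z ->
  'D_X (fun S' => bw_metric S' Y Z) S =
  - (2^-1 * \tr ((X *m lyap S Y + lyap S Y *m X) *m lyap S Z)).
Proof.
move=> rS Xs Ys Zs; rewrite derive_line.
have nE : \forall h \near (0 : R), bw_metric (S + h *: X) Y Z =
    2^-1 * \tr (lyap (S + h *: X) Y *m Z).
  by apply: filterS (regular_near rS Xs) => h rh; rewrite bw_metricE'.
rewrite (near_eq_derive _ nE).
have := mx_is_derive_trace
  (mx_is_deriveM (mx_is_derive_lyap Y rS Xs) (mx_is_derive_cst Z)).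
rewrite mulmx0 addr0 mulNmx mxtraceN mxtrace_lyap// => dt.
have := is_deriveM (is_derive_cst (2^-1 : R) (0 : R) 1) dt.
by move=> h; rewrite derive_val scaler0 addr0 scalerN.
Qed.

(** Twice the Koszul formula for $-(USV+VSU)$, with the metric and its derivatives written as
    traces; [T] is the tangent vector whose velocity is the test direction. *)
Lemma christoffel_trace S U V T : S^T = S -> U^T = U -> V^T = V -> T^T = T ->
  2 * \tr (- (U *m S *m V + V *m S *m U) *m T) =
  - \tr ((velocity S U *m V + V *m velocity S U) *m T)
  - \tr ((velocity S V *m U + U *m velocity S V) *m T)
  + \tr ((velocity S T *m U + U *m velocity S T) *m V).
Proof.
move=> Ss Us Vs Ts; rewrite /velocity.
rewrite !(mulmxDl, mulmxDr, mulNmx, mulmxA) !(mxtraceD, mxtraceN).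
have e1 : \tr (T *m S *m U *m V) = \tr (S *m U *m V *m T) by word4.
have e2 : \tr (U *m S *m T *m V) = \tr (S *m U *m V *m T) by word4.
have e3 : \tr (V *m U *m S *m T) = \tr (S *m U *m V *m T) by word4.
have e4 : \tr (S *m T *m U *m V) = \tr (S *m V *m U *m T) by word4.
have e5 : \tr (U *m V *m S *m T) = \tr (S *m V *m U *m T) by word4.
have e6 : \tr (U *m T *m S *m V) = \tr (S *m V *m U *m T) by word4.
by rewrite e1 e2 e3 e4 e5 e6; ring.
Qed.

Lemma christoffelE S X Y (U := lyap S X) (V := lyap S Y) :
  regular S -> X^T = X -> Y^T = Y ->
  christoffel S X Y = - (U *m S *m V + V *m S *m U).
Proof.
move=> rS Xs Ys; have Us := lyap_sym rS Xs; have Vs := lyap_sym rS Ys.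
have Ws : (- (U *m S *m V + V *m S *m U))^T = - (U *m S *m V + V *m S *m U).
  rewrite [LHS]linearN /= [(_ + _)^T]linearD /= !trmx_mul Us Vs rS.1 !mulmxA.
  by rewrite addrC.
apply: xget_unique => [|W [/= Ws' WE]].
  split=> // Z Zs; have Ts := lyap_sym rS Zs.
  rewrite bw_metricE// !derive_metric//.
  have := christoffel_trace rS.1 Us Vs Ts.
  rewrite /U /V !velocityK// -/U -/V => h.
  by lra.
set W0 := - _ in Ws *.
have Es : (W - W0)^T = W - W0 by rewrite [(_ - _)^T]linearB /= Ws' Ws.
(* Uniqueness: the Koszul formula is tested in the direction [velocity S (W - W0)], for which the
   pairing of the difference becomes its squared Frobenius norm. *)
have Zs : (velocity S (W - W0))^T = velocity S (W - W0).
  by rewrite [LHS]linearD /= !trmx_mul Es rS.1 addrC.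
have := WE _ Zs; rewrite bw_metricE// !derive_metric//.
have := christoffel_trace rS.1 Us Vs Es.
rewrite /U /V !velocityK// -/U -/V lyapK// -/W0 => h1 h2.
apply/eqP; rewrite -subr_eq0; apply/eqP/mxtrace_sqr_eq0.
by rewrite Es mulmxBl mxtraceD mxtraceN h2; lra.
Qed.

Lemma bw_metric_lyap S X Y : regular S -> X^T = X -> Y^T = Y ->
  bw_metric S X Y = 2^-1 * \tr (X *m lyap S Y).
Proof. by move=> rS Xs Ys; rewrite bw_metricE'// mxtrace_lyap. Qed.

Definition christoffel_derivative S X A B (a := lyap S A) (b := lyap S B)
    (da := - lyap S (X *m a + a *m X)) (db := - lyap S (X *m b + b *m X)) :=
  - ((da *m S + a *m X) *m b + a *m S *m db
     + ((db *m S + b *m X) *m a + b *m S *m da)).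

Lemma mx_is_derive_christoffel S X A B : regular S ->
  X^T = X -> A^T = A -> B^T = B ->
  mx_is_derive (fun h : R => christoffel (S + h *: X) A B)
    (christoffel_derivative S X A B).
Proof.
move=> rS Xs As Bs.
apply: (@mx_is_derive_near _ _ _ _ (fun h : R =>
  - (lyap (S + h *: X) A *m (S + h *: X) *m lyap (S + h *: X) B +
     lyap (S + h *: X) B *m (S + h *: X) *m lyap (S + h *: X) A))).
  by apply: filterS (regular_near rS Xs) => h rh; rewrite christoffelE.
have dA := mx_is_derive_lyap A rS Xs; have dB := mx_is_derive_lyap B rS Xs.
have dS := mx_is_derive_line S X.
have := mx_is_deriveN (mx_is_deriveD
  (mx_is_deriveM (mx_is_deriveM dA dS) dB) (mx_is_deriveM (mx_is_deriveM dB dS) dA)).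
by rewrite !scale0r !addr0.
Qed.

Lemma derive_christoffel S X A B : regular S ->
  X^T = X -> A^T = A -> B^T = B ->
  'D_X (fun S' => christoffel S' A B) S = christoffel_derivative S X A B.
Proof.
move=> rS Xs As Bs; rewrite derive_line.
exact/mx_is_derive_derive/mx_is_derive_christoffel.
Qed.

(** With $L$ the inverse of [velocity S], the letters will stand for $e=L(UVS+SVU)$, $m=L(USV+VSU)$,
    $q=L(YV+VY)$ and $G=L(-2VSV)$, while [p] and [p'] are the values of $L(XV+VX)$ and $L(YU+UY)$.
    Traces with [m] cancel; those with [q] and [G] are eliminated by pairing their equations with
    $U^2$. *)
Lemma curvature_trace_words S U V (e m q G : 'M[R]_n)
    (X := velocity S U) (Y := velocity S V) (p := U *m V + V *m U - e + m) (p' := e + m) :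
  S^T = S -> U^T = U -> V^T = V -> e^T = e -> m^T = m -> q^T = q -> G^T = G ->
  velocity S q = Y *m V + V *m Y ->
  velocity S G = - (V *m S *m V + V *m S *m V) ->
  \tr ((- ((- p *m S + V *m X) *m V + V *m S *m - p
        + ((- p *m S + V *m X) *m V + V *m S *m - p))
     - - ((- p' *m S + U *m Y) *m V + U *m S *m - q
        + ((- q *m S + V *m Y) *m U + V *m S *m - p'))
     + - (U *m S *m G + G *m S *m U)
     - - (V *m S *m - m + - m *m S *m V)) *m U) =
  6 * \tr (S *m V *m U *m U *m V) - 6 * \tr (S *m V *m U *m e).
Proof.
move=> Ss Us Vs es ms qs Gs hq hG.
have {hq} : \tr (velocity S q *m U *m U) = \tr ((Y *m V + V *m Y) *m U *m U).
  by rewrite hq.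
have {hG} : \tr (velocity S G *m U *m U) = \tr (- (V *m S *m V + V *m S *m V) *m U *m U).
  by rewrite hG.
rewrite /p /p' /X /Y /velocity {p p' X Y}.
rewrite !(opprD, opprK, mulmxDl, mulmxDr, mulNmx, mulmxN, mulmxA).
rewrite !(mxtraceD, mxtraceN, opprD, opprK).
collect5 (\tr (S *m U *m V *m U *m V)).
collect5 (\tr (S *m V *m U *m U *m V)).
collect5 (\tr (S *m V *m V *m U *m U)).
collect4 (\tr (S *m V *m U *m e)).
collect4 (\tr (S *m V *m U *m m)).
collect4 (\tr (S *m U *m U *m q)).
collect4 (\tr (S *m U *m U *m G)).
move: (\tr (S *m U *m V *m U *m V)) (\tr (S *m V *m U *m U *m V))
  (\tr (S *m V *m V *m U *m U)) (\tr (S *m V *m U *m e)) (\tr (S *m V *m U *m m))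
  (\tr (S *m U *m U *m q)) (\tr (S *m U *m U *m G)).
by move=> b g f x y t s; lra.
Qed.

(* The last identity exhibits the numerator of the sectional curvature as
   3/4 of the squared norm of [K + w], as in O'Neill's formula. *)
Lemma vertical_trace_words S U V (e w : 'M[R]_n) (K := U *m V - V *m U) :
  S^T = S -> U^T = U -> V^T = V -> w^T = w ->
  e + e = U *m V + V *m U - w -> velocity S w = S *m K - K *m S ->
  [/\ 4 * (6 * \tr (S *m V *m U *m U *m V) - 6 * \tr (S *m V *m U *m e)) =
      6 * \tr (K *m S *m K^T) - 3 * \tr (velocity S w *m w),
      \tr (velocity S w *m w) = 2 * \tr (w *m S *m w^T)
    & \tr ((K + w) *m S *m (K + w)^T) =
      \tr (K *m S *m K^T) - 2^-1 * \tr (velocity S w *m w)].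
Proof.
move=> Ss Us Vs ws he hw.
have KT : K^T = V *m U - U *m V by rewrite [LHS]linearB /= !trmx_mul Us Vs.
(* The two matrix equations are used only through three traces: that of [w] against $UV+VU$ and
   against [w], and that of [e] against $SVU$. *)
have hJ : \tr (velocity S w *m (U *m V + V *m U)) =
    \tr ((S *m K - K *m S) *m (U *m V + V *m U)) by rewrite hw.
have hw2 : \tr (velocity S w *m w) = \tr ((S *m K - K *m S) *m w) by rewrite hw.
have he2 : \tr (S *m V *m U *m (e + e)) = \tr (S *m V *m U *m (U *m V + V *m U - w)).
  by rewrite he.
have hww : \tr (velocity S w *m w) = 2 * \tr (w *m S *m w^T).
  rewrite ws mulmxDl mxtraceD mulrDl mul1r; congr (_ + _).
  by rewrite mxtrace_mulC mulmxA.
move: hww hw2 hJ he2; rewrite [(K + w)^T]linearD /= KT ws.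
rewrite /K /velocity {K KT hw he}.
rewrite !(opprD, opprK, mulmxDl, mulmxDr, mulNmx, mulmxN, mulmxA).
rewrite !(mxtraceD, mxtraceN, opprD, opprK).
collect5 (\tr (S *m U *m V *m U *m V)).
collect5 (\tr (S *m V *m U *m U *m V)).
collect5 (\tr (S *m U *m V *m V *m U)).
collect4 (\tr (S *m V *m U *m w)).
collect4 (\tr (S *m U *m V *m w)).
move: (\tr (S *m U *m V *m U *m V)) (\tr (S *m V *m U *m U *m V))
  (\tr (S *m U *m V *m V *m U)) (\tr (S *m V *m U *m e)) (\tr (S *m V *m U *m w))
  (\tr (S *m U *m V *m w)) (\tr (S *m w *m w)) (\tr (w *m S *m w)).
move=> b g c x y z s t h1 h2 h3 h4.
by split; lra.
Qed.

Lemma christoffel_sym S X Y : regular S -> X^T = X -> Y^T = Y ->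
  (christoffel S X Y)^T = christoffel S X Y.
Proof.
move=> rS Xs Ys; rewrite christoffelE// [LHS]linearN /= [(_ + _)^T]linearD /=.
by rewrite !trmx_mul !lyap_sym// rS.1 !mulmxA addrC.
Qed.

Lemma christoffel_derivative_sym S X A B : regular S ->
  X^T = X -> A^T = A -> B^T = B ->
  (christoffel_derivative S X A B)^T = christoffel_derivative S X A B.
Proof.
move=> rS Xs As Bs; rewrite /christoffel_derivative.
have as_ := lyap_sym rS As; have bs := lyap_sym rS Bs.
have das : (- lyap S (X *m lyap S A + lyap S A *m X))^T =
    - lyap S (X *m lyap S A + lyap S A *m X).
  by rewrite [LHS]linearN /= lyap_sym// [LHS]linearD /= !trmx_mul Xs as_ addrC.
have dbs : (- lyap S (X *m lyap S B + lyap S B *m X))^T =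
    - lyap S (X *m lyap S B + lyap S B *m X).
  by rewrite [LHS]linearN /= lyap_sym// [LHS]linearD /= !trmx_mul Xs bs addrC.
move: (- lyap _ _) (- lyap _ _) das dbs => da db das dbs.
move: (lyap S A) (lyap S B) as_ bs => a b as_ bs.
have tD (M N : 'M[R]_n) : (M + N)^T = M^T + N^T by exact: linearD.
rewrite [LHS]linearN /= !(tD, trmx_mul, as_, bs, das, dbs, Xs, rS.1); congr (- _).
rewrite !(mulmxDl, mulmxDr, mulmxA).
move: (_ *m b) (_ *m db) (_ *m a) (_ *m b) (_ *m da) (_ *m a) => c1 c2 c3 c4 c5 c6.
by apply/matrixP => i j; rewrite !mxE; ring.
Qed.

Lemma curvatureE S X Y (U := lyap S X) (V := lyap S Y)
    (G := lyap S (- (V *m S *m V + V *m S *m V)))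
    (H := lyap S (- (U *m S *m V + V *m S *m U))) :
  regular S -> X^T = X -> Y^T = Y ->
  curvature S X Y Y = christoffel_derivative S X Y Y - christoffel_derivative S Y X Y
    + - (U *m S *m G + G *m S *m U) - - (V *m S *m H + H *m S *m V).
Proof.
move=> rS Xs Ys.
have GYs := christoffel_sym rS Ys Ys; have GXYs := christoffel_sym rS Xs Ys.
have E1 := derive_christoffel rS Xs Ys Ys; have E2 := derive_christoffel rS Ys Xs Ys.
have E3 := christoffelE rS Xs GYs; have E4 := christoffelE rS Ys GXYs.
rewrite /curvature; congr (_ - _ + _ - _); [exact: E1|exact: E2| |].
  by rewrite E3 (christoffelE rS Ys Ys).
by rewrite E4 (christoffelE rS Xs Ys).
Qed.

(** Off the symmetric matrices [of_velocity] takes its default value 0, so the trace formula for the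
    metric applies to the curvature only once the latter is known to be symmetric. *)
Lemma curvature_sym S X Y : regular S -> X^T = X -> Y^T = Y ->
  (curvature S X Y Y)^T = curvature S X Y Y.
Proof.
move=> rS Xs Ys.
have E1 := derive_christoffel rS Xs Ys Ys; have E2 := derive_christoffel rS Ys Xs Ys.
have GYs := christoffel_sym rS Ys Ys; have GXYs := christoffel_sym rS Xs Ys.
have sym4 (A B C D : 'M[R]_n) : A^T = A -> B^T = B -> C^T = C -> D^T = D ->
    (A - B + C - D)^T = A - B + C - D.
  move=> As Bs Cs Ds.
  have tD (M N : 'M[R]_n) : (M + N)^T = M^T + N^T by exact: linearD.
  have tN (M : 'M[R]_n) : (- M)^T = - M^T by exact: linearN.
  by rewrite !(tD, tN) As Bs Cs Ds.
apply: sym4.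
- apply: (etrans (congr1 trmx E1)).
  exact: (etrans (christoffel_derivative_sym rS Xs Ys Ys) (esym E1)).
- apply: (etrans (congr1 trmx E2)).
  exact: (etrans (christoffel_derivative_sym rS Ys Xs Ys) (esym E2)).
- exact: christoffel_sym.
- exact: christoffel_sym.
Qed.

Lemma velocity_sym S V : S^T = S -> V^T = V -> (velocity S V)^T = velocity S V.
Proof. by move=> Ss Vs; rewrite [LHS]linearD /= !trmx_mul Vs Ss addrC. Qed.

Lemma mxtrace_spd_ge0 S V : spd S -> 0 <= \tr (V *m S *m V^T).
Proof.
move=> [_ Sp]; rewrite mxtrace_quad sumr_ge0// => i _.
have [->|u0] := eqVneq (row i V) 0; first by rewrite !mul0mx mxE.
exact/ltW/Sp.
Qed.

Lemma curvature_lyap S X Y (U := lyap S X) (V := lyap S Y) (K := U *m V - V *m U) :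
  spd S -> X^T = X -> Y^T = Y ->
  0 <= bw_metric S (curvature S X Y Y) X <= 3 / 4 * \tr (K *m S *m K^T).
Proof.
move=> sS Xs Ys; have rS := spd_regular sS; have Ss := rS.1.
rewrite (bw_metric_lyap rS (curvature_sym rS Xs Ys) Xs) curvatureE//.
have Us := lyap_sym rS Xs; have Vs := lyap_sym rS Ys.
rewrite /christoffel_derivative.
have XE := velocityK rS X; have YE := velocityK rS Y.
rewrite -/U -/V in Us Vs XE YE *.
set E := U *m V *m S + S *m V *m U.
set m := lyap S (U *m S *m V + V *m S *m U).
set D := S *m K - K *m S.
have Es : E^T = E by rewrite [LHS]linearD /= !trmx_mul Us Vs Ss !mulmxA addrC.
have KT : K^T = - K by rewrite [LHS]linearB /= !trmx_mul Us Vs opprB.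
have Ds : D^T = D by rewrite [LHS]linearB /= !trmx_mul KT Ss mulNmx mulmxN opprK addrC.
(* This and the next two identities are checked after applying [velocity S], where they compare
   words of three letters. Here, [velocity S] of $UV+VU$, minus [D], is $2E$. *)
have e2 : lyap S E + lyap S E = U *m V + V *m U - lyap S D.
  rewrite -(lyapK rS (U *m V + V *m U)) -lyapN -!lyapD; congr (lyap S _).
  rewrite /E /D /K /velocity !(mulmxDl, mulmxDr, mulmxBl, mulmxBr, mulNmx, mulmxN).
  rewrite !(opprB, opprD, opprK, mulmxA).
  move: (_ *m S) (S *m _ *m _) (S *m _ *m _) (_ *m S) => c1 c2 c3 c4.
  by apply/matrixP => i j; rewrite !mxE; ring.
have EX : lyap S (X *m V + V *m X) = U *m V + V *m U - lyap S E + m.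
  rewrite -(lyapK rS (U *m V + V *m U)) -lyapN -!lyapD; congr (lyap S _).
  rewrite -XE /E /velocity !(mulmxDl, mulmxDr, opprD, mulmxA).
  move: (S *m U *m V) (U *m S *m V) (V *m S *m U) (V *m U *m S) (S *m V *m U)
    (U *m V *m S) => c1 c2 c3 c4 c5 c6.
  by apply/matrixP => i j; rewrite !mxE; ring.
have EY : lyap S (Y *m U + U *m Y) = lyap S E + m.
  rewrite -!lyapD; congr (lyap S _).
  rewrite -YE /E /velocity !(mulmxDl, mulmxDr, mulmxA).
  move: (S *m V *m U) (U *m S *m V) (V *m S *m U) (U *m V *m S) => c2 c3 c5 c6.
  by apply/matrixP => i j; rewrite !mxE; ring.
have EH : lyap S (- (U *m S *m V + V *m S *m U)) = - m by rewrite lyapN.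
rewrite EX EY EH.
have ms : m^T = m.
  by apply: lyap_sym => //; rewrite [LHS]linearD /= !trmx_mul Us Vs Ss !mulmxA addrC.
have qs : (lyap S (Y *m V + V *m Y))^T = lyap S (Y *m V + V *m Y).
  by apply: lyap_sym => //; rewrite [LHS]linearD /= !trmx_mul Ys Vs addrC.
have Gs : (lyap S (- (V *m S *m V + V *m S *m V)))^T =
    lyap S (- (V *m S *m V + V *m S *m V)).
  apply: lyap_sym => //; rewrite [LHS]linearN /= [(_ + _)^T]linearD /= !trmx_mul.
  by rewrite Vs Ss !mulmxA.
have := curvature_trace_words Ss Us Vs (lyap_sym rS Es) ms qs Gs.
rewrite XE YE !(velocityK rS) => /(_ erefl erefl) ->.
have := vertical_trace_words Ss Us Vs (lyap_sym rS Ds) e2.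
rewrite -/K !(velocityK rS) -/D => /(_ erefl) [h1 h2 h3].
have g1 := @mxtrace_spd_ge0 S (lyap S D) sS.
have g2 := @mxtrace_spd_ge0 S (K + lyap S D) sS.
by apply/andP; split; lra.
Qed.

End lyap_derive.

(** * Continuity of matrix-valued maps *)

Section continuity.
Variables (R : realType) (T : topologicalType).

Definition mx_continuous m n (f : T -> 'M[R]_(m, n)) :=
  forall i j, continuous (fun x => f x i j : R).

Lemma mx_continuous_trmx m n (f : T -> 'M[R]_(m, n)) :
  mx_continuous f -> mx_continuous (fun x => (f x)^T).
Proof.
move=> fc i j; rewrite (_ : (fun x => _) = fun x => f x j i); first exact: fc.
by apply/funext => x; rewrite mxE.
Qed.

Lemma continuous_bigsum (I : Type) (r : seq I) (F : I -> T -> R) :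
  (forall i, continuous (F i)) -> continuous (fun x => \sum_(i <- r) F i x).
Proof.
move=> Fc; elim: r => [|i r ih] x.
  by under eq_fun do rewrite big_nil; exact: cvg_cst.
under eq_fun do rewrite big_cons.
by apply: cvgD; [exact: Fc|exact: ih].
Qed.

Lemma mx_continuousP m n (f : T -> 'M[R]_(m, n)) : mx_continuous f -> continuous f.
Proof.
move=> fc x B [P Pn PB].
have : \forall y \near x, forall i j, P i j (f y i j).
  by apply: filter_forall => i; apply: filter_forall => j; exact: fc (Pn i j).
by apply: filterS => y Py; apply: PB => i j; exact: Py.
Qed.

Lemma mx_continuousD m n (f g : T -> 'M[R]_(m, n)) :
  mx_continuous f -> mx_continuous g -> mx_continuous (fun x => f x + g x).
Proof.
move=> fc gc i j; rewrite (_ : (fun x => _) = fun x => f x i j + g x i j).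
  by move=> x; apply: cvgD; [exact: fc|exact: gc].
by apply/funext => x; rewrite mxE.
Qed.

Lemma mx_continuousN m n (f : T -> 'M[R]_(m, n)) :
  mx_continuous f -> mx_continuous (fun x => - f x).
Proof.
move=> fc i j; rewrite (_ : (fun x => _) = fun x => - f x i j).
  by move=> x; apply: cvgN; exact: fc.
by apply/funext => x; rewrite mxE.
Qed.

Lemma mx_continuous_cst m n (A : 'M[R]_(m, n)) : mx_continuous (fun=> A).
Proof. by move=> i j x; exact: cvg_cst. Qed.

Lemma mx_continuousM m n p (f : T -> 'M[R]_(m, n)) (g : T -> 'M[R]_(n, p)) :
  mx_continuous f -> mx_continuous g -> mx_continuous (fun x => f x *m g x).
Proof.
move=> fc gc i j; rewrite (_ : (fun x => _) = fun x => \sum_k f x i k * g x k j).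
  by apply: continuous_bigsum => k x; apply: cvgM; [exact: fc|exact: gc].
by apply/funext => x; rewrite mxE.
Qed.

Lemma mx_continuous_trace n (f : T -> 'M[R]_n) :
  mx_continuous f -> continuous (fun x => \tr (f x)).
Proof. by move=> fc; apply: continuous_bigsum => k; exact: fc. Qed.

End continuity.

Lemma entry_le_hs_norm (R : realType) m n (A : 'M[R]_(m, n)) i j : `|A i j| <= hs_norm A.
Proof.
rewrite -sqrtr_sqr ler_wsqrtr// mxtrace_mulT (bigD1 i)//= (bigD1 j)//= -expr2.
rewrite -addrA lerDl addr_ge0// sumr_ge0// => k _; last first.
  by rewrite sumr_ge0// => l _; rewrite -expr2 sqr_ge0.
by rewrite -expr2 sqr_ge0.
Qed.

(** * Bound on the sectional curvature *)

Section curvature_bound.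
Variables (R : realType) (n : nat).
Implicit Types S U V : 'M[R]_n.

Lemma hs_normB m p (A B : 'M[R]_(m, p)) : hs_norm (A - B) <= hs_norm A + hs_norm B.
Proof. by rewrite (le_trans (hs_norm_triangle _ _))// hs_normN. Qed.

Lemma hs_norm_lcomm U V : hs_norm (U *m V - V *m U) <= 2 * (hs_norm U * hs_norm V).
Proof.
apply: (le_trans (hs_normB _ _)); rewrite mulrDl mul1r lerD//.
  exact: hs_normM.
by rewrite mulrC hs_normM.
Qed.

Lemma bw_innerC S U V : sym S -> sym U -> sym V -> bw_inner S U V = bw_inner S V U.
Proof.
move=> Ss Us Vs; rewrite /bw_inner -[LHS]mxtrace_tr !trmx_mul Ss Us Vs.
by rewrite mulmxA.
Qed.

(** With [V'] the component of [V] orthogonal to [U], the commutator has Frobenius norm at most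
    $2\|U\|_F\|V'\|_F$ and the Gram determinant is at least $a^2\|U\|_F^2\|V'\|_F^2$. The constant
    is thus $\frac34 \cdot b \cdot 2^2 / a^2$. *)
Lemma sectional_curvature_bound S (a b : R) U V : spd S -> 0 < a -> 0 <= b ->
  (forall W : 'M[R]_n, a * hs_norm W ^+ 2 <= \tr (W *m S *m W^T) <= b * hs_norm W ^+ 2) ->
  sym U -> sym V ->
  `|sectional_curvature S U V| <= 3 * b / a ^+ 2.
Proof.
move=> sS a0 b0 ab Us Vs; have rS := spd_regular sS.
have Xs := velocity_sym rS.1 Us; have Ys := velocity_sym rS.1 Vs.
have := curvature_lyap sS Xs Ys; rewrite !(lyapK rS) /sectional_curvature.
set N := bw_metric _ _ _.
set G := bw_inner S U U * _ - _.
(* For a degenerate Gram determinant the quotient is 0, since the inverse of 0 is 0. *)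
have [->|G0] := eqVneq G 0.
  move=> _; rewrite invr0 mulr0 normr0.
  by apply: divr_ge0; [exact: mulr_ge0|exact: sqr_ge0].
have UU0 : 0 <= bw_inner S U U by rewrite /bw_inner -{2}Us; exact: mxtrace_spd_ge0.
have Un0 : bw_inner S U U != 0.
  apply: contra G0 => /eqP UU.
  have hU : hs_norm U ^+ 2 = 0.
    apply/eqP; rewrite eq_le sqr_ge0 andbT.
    have /andP[+ _] := ab U; rewrite Us -/(bw_inner S U U) UU.
    by rewrite pmulr_rle0.
  have U0 : U = 0 by apply: mxtrace_sqr_eq0; rewrite -hs_norm_sqr.
  by rewrite /G U0 /bw_inner !mul0mx !mxtrace0 mul0r expr0n subrr.
pose t := bw_inner S U V / bw_inner S U U.
pose V' := V - t *: U.
have V's : sym V' by rewrite /sym /= [(_ - _)^T]linearB /= linearZ /= Us Vs.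
have V'E : bw_inner S V' V' = bw_inner S V V - t * bw_inner S U V
    - (t * bw_inner S U V - t * (t * bw_inner S U U)).
  rewrite {1}/bw_inner /V' mulmxBl -scalemxAl !mulmxBl !mulmxBr -!scalemxAl -!scalemxAr.
  rewrite !(mxtraceD, mxtraceN, mxtraceZ) -/(bw_inner S V V) -/(bw_inner S U V).
  rewrite -/(bw_inner S V U) -/(bw_inner S U U) (bw_innerC rS.1 Vs Us).
  by [].
have GE : G = bw_inner S U U * bw_inner S V' V'.
  by rewrite V'E /G /t; field.
have KE : U *m V - V *m U = U *m V' - V' *m U.
  by rewrite /V' mulmxBr mulmxBl -scalemxAl -scalemxAr opprB addrA addrNK.
rewrite KE => /andP[N0 NK].
have V'V'0 : 0 <= bw_inner S V' V'.
  by rewrite /bw_inner -{2}V's; exact: mxtrace_spd_ge0.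
have Gp : 0 < G by rewrite lt_def G0 GE mulr_ge0.
rewrite normrM normfV !ger0_norm ?(ltW Gp)// ler_pdivrMr// mulrAC ler_pdivlMr ?exprn_gt0//.
have /andP[_ hK] := ab (U *m V' - V' *m U).
have /andP[hU _] := ab U; have /andP[hV _] := ab V'.
rewrite Us -/(bw_inner S U U) in hU; rewrite V's -/(bw_inner S V' V') in hV.
have hc := hs_norm_lcomm U V'.
have uv : (a * hs_norm U ^+ 2) * (a * hs_norm V' ^+ 2) <= G.
  by rewrite GE ler_pM// mulr_ge0 ?sqr_ge0// ltW.
have k2 : hs_norm (U *m V' - V' *m U) ^+ 2 <= 4 * (hs_norm U ^+ 2 * hs_norm V' ^+ 2).
  have -> : 4 * (hs_norm U ^+ 2 * hs_norm V' ^+ 2) = (2 * (hs_norm U * hs_norm V')) ^+ 2 by ring.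
  by rewrite ler_pXn2r ?nnegrE ?hs_norm_ge0// !mulr_ge0 ?hs_norm_ge0.
have a2 : 0 <= a ^+ 2 by rewrite sqr_ge0.
have s1 : N <= 3 * b * (hs_norm U ^+ 2 * hs_norm V' ^+ 2).
  apply: (le_trans NK).
  apply: (@le_trans _ _ (3 / 4 * (b * (4 * (hs_norm U ^+ 2 * hs_norm V' ^+ 2))))).
    by rewrite ler_pM2l//; apply: (le_trans hK); rewrite ler_wpM2l.
  by rewrite le_eqVlt; apply/orP; left; apply/eqP; field.
apply: (@le_trans _ _ (3 * b * (hs_norm U ^+ 2 * hs_norm V' ^+ 2) * a ^+ 2)).
  by rewrite ler_wpM2r.
have -> : 3 * b * (hs_norm U ^+ 2 * hs_norm V' ^+ 2) * a ^+ 2 =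
  3 * b * ((a * hs_norm U ^+ 2) * (a * hs_norm V' ^+ 2)) by ring.
by rewrite ler_wpM2l// mulr_ge0.
Qed.
End curvature_bound.

(** * Wasserstein balls *)

Section ball.
Variables (R : realType) (n : nat).
Implicit Types S U V M : 'M[R]_n.

Lemma bw_normE S A V : A *m A = S -> sym A -> sym V -> bw_norm S V = hs_norm (V *m A).
Proof.
move=> <- As Vs; rewrite /bw_norm /hs_norm /bw_inner trmx_mul As Vs.
by rewrite !mulmxA.
Qed.

(** The inverse map $M^{-1}$ transports $MSM$ back to [S], and $(M^{-1}-1)M = 1-M$ returns the norm
    at [S]. *)
Lemma W2_transport_sym S M : spd S -> spd M ->
  W2 (M *m S *m M) S = bw_norm S (M - 1%:M).
Proof.
move=> sS sM; have Mu := spd_unit sM; have Ms : M^T = M := sM.1.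
have sS' : spd (M *m S *m M) by rewrite -{2}Ms; exact: spd_congr.
have SE : invmx M *m (M *m S *m M) *m invmx M = S.
  by rewrite !mulmxA mulVmx// mul1mx mulmxK.
rewrite -{2}SE W2_transport//; last exact: spd_inv.
congr Num.sqrt; rewrite /bw_inner.
have -> : (invmx M - 1%:M) *m (M *m S *m M) *m (invmx M - 1%:M) =
    ((invmx M - 1%:M) *m M) *m S *m (M *m (invmx M - 1%:M)) by rewrite !mulmxA.
rewrite mulmxBl mulmxBr mulVmx// mulmxV// mul1mx mulmx1.
by rewrite -opprB !mulNmx mulmxN opprK.
Qed.

(** By Cauchy-Schwarz $|uVu^T| \le \|V\|_F|u|^2 < |u|^2$ for nonzero [u]. *)
Lemma spd_perturb V : sym V -> hs_norm V < 1 -> spd (1%:M + V).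
Proof.
move=> Vs V1; split; first by rewrite /sym /= [LHS]linearD /= trmx1 Vs.
move=> u u0; rewrite mulmxDr mulmx1 mulmxDl.
have q0 : 0 < (u *m u^T) 0 0 by rewrite lt_def sqnorm_eq0 u0 sqnorm_ge0.
have tr1 (B : 'M[R]_1) : B 0 0 = \tr B by rewrite /mxtrace big_ord1.
have := hs_norm_cauchy (u *m V) u.
have : hs_norm (u *m V) * hs_norm u <= hs_norm V * (u *m u^T) 0 0.
  rewrite tr1 -hs_norm_sqr expr2 mulrA ler_wpM2r ?hs_norm_ge0//.
  by rewrite mulrC hs_normM.
rewrite -tr1 => h1 h2; have := ler_norm (- (u *m V *m u^T) 0 0).
rewrite normrN => h3; rewrite mxE.
have : hs_norm V * (u *m u^T) 0 0 < (u *m u^T) 0 0 by rewrite gtr_pMl.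
lra.
Qed.

Section bounds.
Variables (Sstar : 'M[R]_n) (ld l1 r : R).
Hypotheses (sS : spd Sstar) (ld0 : 0 < ld) (l10 : 0 <= l1) (r0 : 0 < r) (rld : r < Num.sqrt ld / 2).
Hypothesis quad : forall u : 'rV[R]_n,
  ld * (u *m u^T) 0 0 <= (u *m Sstar *m u^T) 0 0 <= l1 * (u *m u^T) 0 0.

Lemma trace_bounds m (V : 'M[R]_(m, n)) :
  ld * hs_norm V ^+ 2 <= \tr (V *m Sstar *m V^T) <= l1 * hs_norm V ^+ 2.
Proof.
rewrite hs_norm_sqr; apply/andP; split.
  by apply: quad_hs_lbound => u; case/andP: (quad u).
by apply: quad_hs_bound => u; case/andP: (quad u).
Qed.

Lemma sqrt_mul_le (c x t : R) : 0 <= c -> 0 <= x -> c * x ^+ 2 <= t ->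
  Num.sqrt c * x <= Num.sqrt t.
Proof.
by move=> c0 x0 h; rewrite -{1}(ger0_norm x0) -sqrtr_sqr -sqrtrM// ler_wsqrtr.
Qed.

Lemma bw_norm_star V : sym V -> Num.sqrt ld * hs_norm V <= bw_norm Sstar V.
Proof.
move=> Vs; apply: sqrt_mul_le; [exact: ltW|exact: hs_norm_ge0|].
by have /andP[+ _] := trace_bounds V; rewrite Vs.
Qed.

Lemma rad_pos : r < Num.sqrt ld - r.
Proof.
have s0 : 0 < Num.sqrt ld by rewrite sqrtr_gt0.
by move: s0 rld; move: (Num.sqrt ld) => s s0 h; lra.
Qed.

Lemma near_id_hs M : sym M -> bw_norm Sstar (M - 1%:M) <= r -> hs_norm (M - 1%:M) < 1.
Proof.
move=> Ms Mr; have Ns : sym (M - 1%:M) by rewrite /sym /= [LHS]linearB /= Ms trmx1.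
have sld : 0 < Num.sqrt ld by rewrite sqrtr_gt0.
rewrite -(ltr_pM2l sld) mulr1; apply: (le_lt_trans (bw_norm_star Ns)).
by apply: (le_lt_trans Mr); apply: (lt_trans rld); lra.
Qed.

(** Positive definiteness, an open condition, is automatic within this radius; the ball is therefore
    parametrized by closed conditions on [M] alone. *)
Lemma near_id_spd M : sym M -> bw_norm Sstar (M - 1%:M) <= r -> spd M.
Proof.
move=> Ms Mr; have Ns : sym (M - 1%:M) by rewrite /sym /= [LHS]linearB /= Ms trmx1.
by rewrite -(subrKC 1%:M M); apply: spd_perturb => //; exact: near_id_hs.
Qed.

Lemma ballE S : W2_ball Sstar r S <->
  exists M, [/\ sym M, bw_norm Sstar (M - 1%:M) <= r & M *m Sstar *m M = S].
Proof.
split=> [[sS' WS]|[M [Ms Mr <-]]].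
  have [M sM ME] := spd_transport sS sS'; exists M; split=> //; first exact: sM.1.
  by have := W2_transport_sym sS sM; rewrite ME => <-.
have sM := near_id_spd Ms Mr; split; last by rewrite W2_transport_sym.
by rewrite -{2}Ms; apply: spd_congr => //; exact: spd_unit.
Qed.

(** Stated for arbitrary [V], because it is applied to commutators, which are skew, and to products
    such as $(M-1)A$. *)
Lemma ball_bounds S m (V : 'M[R]_(m, n)) : W2_ball Sstar r S ->
  (Num.sqrt ld - r) * hs_norm V <= Num.sqrt (\tr (V *m S *m V^T))
    <= (Num.sqrt l1 + r) * hs_norm V.
Proof.
move=> /ballE[M [Ms Mr <-]]; have [A sA AA] := spd_sqrt sS.
have As : A^T = A := sA.1.
have Ns : sym (M - 1%:M) by rewrite /sym /= [LHS]linearB /= Ms trmx1.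
rewrite (bw_normE AA As Ns) in Mr.
have -> : Num.sqrt (\tr (V *m (M *m Sstar *m M) *m V^T)) = hs_norm (V *m M *m A).
  by rewrite /hs_norm !trmx_mul As Ms -AA !mulmxA.
have -> : V *m M *m A = V *m A + V *m ((M - 1%:M) *m A).
  by rewrite -mulmxDr mulmxBl mul1mx addrC subrK mulmxA.
have h := hs_normM V ((M - 1%:M) *m A).
have hV := hs_norm_ge0 V.
have h' : hs_norm V * hs_norm ((M - 1%:M) *m A) <= hs_norm V * r by rewrite ler_wpM2l.
have AE : hs_norm (V *m A) = Num.sqrt (\tr (V *m Sstar *m V^T)).
  by rewrite /hs_norm !trmx_mul As -AA !mulmxA.
have /andP[t1 t2] := trace_bounds V.
have l1_ : Num.sqrt ld * hs_norm V <= hs_norm (V *m A).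
  by rewrite AE; apply: sqrt_mul_le => //; exact: ltW.
have l2_ : hs_norm (V *m A) <= Num.sqrt l1 * hs_norm V.
  rewrite AE -{1}(ger0_norm hV) -sqrtr_sqr -sqrtrM//.
  by rewrite ler_wsqrtr.
have := hs_norm_triangle (V *m A) (V *m ((M - 1%:M) *m A)).
have := hs_normB (V *m A + V *m ((M - 1%:M) *m A)) (V *m ((M - 1%:M) *m A)).
rewrite addrK => g1 g2; apply/andP; split; lra.
Qed.

Lemma ball_trace_bounds S m (V : 'M[R]_(m, n)) : W2_ball Sstar r S ->
  (Num.sqrt ld - r) ^+ 2 * hs_norm V ^+ 2 <= \tr (V *m S *m V^T)
    <= (Num.sqrt l1 + r) ^+ 2 * hs_norm V ^+ 2.
Proof.
move=> BS; have /andP[h1 h2] := ball_bounds V BS; have [sS' _] := BS.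
have lr : 0 <= Num.sqrt ld - r by exact/ltW/(lt_trans r0)/rad_pos.
have t0 : 0 <= \tr (V *m S *m V^T).
  rewrite mxtrace_quad sumr_ge0// => i _.
  have [->|u0] := eqVneq (row i V) 0; first by rewrite !mul0mx mxE.
  exact/ltW/(sS'.2).
rewrite -!exprMn -(sqr_sqrtr t0) !ler_pXn2r ?h1 ?h2// nnegrE ?sqrtr_ge0//.
  by rewrite mulr_ge0 ?hs_norm_ge0 ?addr_ge0 ?sqrtr_ge0 ?(ltW r0).
by rewrite mulr_ge0 ?hs_norm_ge0.
Qed.

Lemma ball_compact : compact (W2_ball Sstar r).
Proof.
(* The parameter matrices are vectorized so that the Heine-Borel property of row vectors applies. *)
pose N (v : 'rV[R]_(n * n)) : 'M[R]_n := vec_mx v.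
have Nc : mx_continuous N.
  move=> i j; rewrite (_ : (fun v => _) = fun v : 'rV[R]_(n * n) => v 0 (mxvec_index i j)).
    exact: coord_continuous.
  by apply/funext => v; rewrite /N mxE.
pose f v := N v *m Sstar *m N v.
have fc : continuous f.
  apply: mx_continuousP; apply: mx_continuousM => //.
  by apply: mx_continuousM => //; exact: mx_continuous_cst.
pose K := [set v | sym (N v) /\ bw_norm Sstar (N v - 1%:M) <= r].
have -> : W2_ball Sstar r = f @` K.
  apply/seteqP; split => [S /ballE[M [Ms Mr <-]]|_ [v [Ks Kr] <-]].
    by exists (mxvec M); rewrite /f /K /N /= mxvecK.
  by apply/ballE; exists (N v).
apply: continuous_compact; first exact: continuous_subspaceT.
have Nd : mx_continuous (fun v => N v + - 1%:M).
  by apply: mx_continuousD => //; exact: mx_continuous_cst.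
apply: bounded_closed_compact.
  exists (hs_norm (1%:M : 'M[R]_n) + 1); split; first by rewrite num_real.
  move=> x x2 v [Ns Nr]; apply: (le_trans _ (ltW x2)).
  rewrite [leLHS]/Num.Def.normr /= mx_normrE; apply/bigmax_leP; split => [|[i k] _ /=].
    by rewrite addr_ge0 ?hs_norm_ge0.
  rewrite ord1; case/mxvec_indexP: k => {}i j.
  have -> : v 0 (mxvec_index i j) = N v i j by rewrite /N mxE.
  apply: (le_trans (entry_le_hs_norm _ _ _)); rewrite -[N v](subrKC 1%:M).
  apply: (le_trans (hs_norm_triangle _ _)); rewrite lerD2l ltW//.
  exact: near_id_hs.
(* Symmetry and the radius condition become sublevel sets of continuous functions: [g] is the
   squared norm of the antisymmetric defect, and [q] is the squared radius on symmetric matrices. *)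
pose g v := \tr ((N v + - (N v)^T) *m (N v + - (N v)^T)^T).
pose q v := \tr ((N v + - 1%:M) *m Sstar *m (N v + - 1%:M)^T).
have gc : continuous g.
  have NTc : mx_continuous (fun v => N v + - (N v)^T).
    apply: mx_continuousD => //; apply: mx_continuousN.
    exact: mx_continuous_trmx.
  by apply: mx_continuous_trace; apply: mx_continuousM => //; exact: mx_continuous_trmx.
have qc : continuous q.
  apply: mx_continuous_trace; apply: mx_continuousM; last exact: mx_continuous_trmx.
  by apply: mx_continuousM => //; exact: mx_continuous_cst.
rewrite (_ : K = (g @^-1` [set x | x <= 0]) `&` (q @^-1` [set x | x <= r ^+ 2])).
  by apply: closedI; apply: (continuous_closedP _).1 => //; exact: closed_le.
have qE v : sym (N v) -> q v = bw_inner Sstar (N v - 1%:M) (N v - 1%:M).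
  by move=> Ns; rewrite /q /bw_inner [(_ + _)^T]linearD /= Ns linearN /= trmx1.
apply/seteqP; split => v /=.
  move=> [Ns Nr]; split; first by rewrite /g Ns subrr mul0mx mxtrace0.
  rewrite -(@ler_sqrt _ _ (r ^+ 2)) ?sqr_ge0// sqrtr_sqr (ger0_norm (ltW r0)).
  by rewrite qE.
move=> [gv qv]; have Ns : sym (N v).
  apply/eqP; rewrite eq_sym -subr_eq0; apply/eqP/mxtrace_sqr_eq0.
  by apply/eqP; rewrite eq_le gv mxtrace_sqr_ge0.
split => //; rewrite /bw_norm -qE// -(ger0_norm (ltW r0)) -sqrtr_sqr.
exact: ler_wsqrtr.
Qed.

(** With $S_1=A^2$, $B=MA$ and $S_2=BB^T$, the difference $X=B-A$ has norm $W_2(S_1,S_2)$, and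
    $S_2-S_1 = XA+(XB^T)^T$. Each term is at most $(\sqrt{\lambda_1^*}+r)\|X\|_F$. *)
Lemma ball_lipschitz S1 S2 : W2_ball Sstar r S1 -> W2_ball Sstar r S2 ->
  hs_norm (S1 - S2) <= 2 * (Num.sqrt l1 + r) * W2 S1 S2.
Proof.
move=> B1 B2; have [sS1 _] := B1; have [sS2 _] := B2.
have [M sM ME] := spd_transport sS1 sS2; have Ms : M^T = M := sM.1.
have [A sA AA] := spd_sqrt sS1; have As : A^T = A := sA.1.
have Ns : sym (M - 1%:M) by rewrite /sym /= [LHS]linearB /= Ms trmx1.
rewrite -{2}ME W2_transport// (bw_normE AA As Ns).
set X := (M - 1%:M) *m A; pose B := M *m A; set c := Num.sqrt l1 + r.
have XE : X = B - A by rewrite /X mulmxBl mul1mx.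
have c0 : 0 <= c by rewrite addr_ge0 ?sqrtr_ge0 ?ltW.
have S2E : S2 = B *m B^T by rewrite -ME -AA /B trmx_mul As Ms !mulmxA.
have XA : hs_norm (X *m A) <= c * hs_norm X.
  have /andP[_] := ball_bounds X B1.
  suff -> : Num.sqrt (\tr (X *m S1 *m X^T)) = hs_norm (X *m A) by [].
  by rewrite /hs_norm (trmx_mul X) As -AA !mulmxA.
have YB (Y : 'M[R]_n) : hs_norm (Y *m B) <= c * hs_norm Y.
  have /andP[_] := ball_bounds Y B2.
  suff -> : Num.sqrt (\tr (Y *m S2 *m Y^T)) = hs_norm (Y *m B) by [].
  by rewrite /hs_norm trmx_mul S2E !mulmxA.
(* The bound at [S2] controls right multiplication by [B], which need not be symmetric. It passes to
   $B^T$ by duality: $\|XB^T\|_F^2 = \operatorname{Tr}(XB^TB\,X^T) \le c\,\|XB^T\|_F\|X\|_F$. *)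
have XB : hs_norm (X *m B^T) <= c * hs_norm X.
  have [->|n0] := eqVneq (hs_norm (X *m B^T)) 0; first by rewrite mulr_ge0 ?hs_norm_ge0.
  have np : 0 < hs_norm (X *m B^T) by rewrite lt_def n0 hs_norm_ge0.
  rewrite -(ler_pM2l np) -expr2 hs_norm_sqr.
  have -> : \tr (X *m B^T *m (X *m B^T)^T) = \tr ((X *m B^T *m B) *m X^T).
    by rewrite (trmx_mul X) trmxK !mulmxA.
  apply: (le_trans (ler_norm _)); apply: (le_trans (hs_norm_cauchy _ _)).
  by rewrite mulrA ler_wpM2r ?hs_norm_ge0// mulrC YB.
have -> : S1 - S2 = - (X *m A + (X *m B^T)^T).
  rewrite (trmx_mul X) trmxK XE [(_ - _)^T]linearB /= As mulmxBl mulmxBr AA -S2E.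
  by rewrite -opprB [X in _ = - X]addrC addrA subrK.
rewrite hs_normN; apply: (le_trans (hs_norm_triangle _ _)); rewrite hs_norm_trmx.
by rewrite -mulrA mulrDl mul1r lerD.
Qed.

End bounds.
End ball.

(* The dimension is d.+1; the tuple lam lists the eigenvalues of Sstar with
   multiplicity, in nonincreasing order. *)
Theorem theorem2 (R : realType) (d : nat) (Sstar : 'M[R]_d.+1)
    (lam : d.+1.-tuple R) (r : R)
    (l1 := tnth lam ord0) (ld := tnth lam ord_max) :
  spd Sstar ->
  char_poly Sstar = \prod_(x <- lam) ('X - x%:P) ->
  sorted (fun x y => y <= x) lam ->
  0 < ld ->
  0 < r -> r < Num.sqrt ld / 2 ->
  [/\ compact (W2_ball Sstar r),
      exists C : R, forall S, W2_ball Sstar r S ->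
        forall U V : 'M[R]_d.+1, sym U -> sym V -> free [:: U; V] ->
          `|sectional_curvature S U V| <= C,
      [/\ forall S V, W2_ball Sstar r S -> sym V ->
            (Num.sqrt ld - r) * frobenius V <= bw_norm S V
              <= (Num.sqrt l1 + r) * frobenius V,
          forall S1 S2 V, W2_ball Sstar r S1 -> W2_ball Sstar r S2 -> sym V ->
            bw_norm S2 V
              <= (Num.sqrt l1 + r) / (Num.sqrt ld - r) * bw_norm S1 V
        & forall S1 S2, W2_ball Sstar r S1 -> W2_ball Sstar r S2 ->
            frobenius (S1 - S2)
              <= 2 * Num.sqrt 2 * (Num.sqrt l1 + Num.sqrt ld) * W2 S1 S2]
    & forall S V, W2_ball Sstar r S -> sym V -> bw_norm S V <= r / 2 ->
        W2 S (bw_exp S V) = bw_norm S V].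
Proof.
move=> sS cp srt ld0 r0 rld.
have quad (u : 'rV[R]_d.+1) : ld * (u *m u^T) 0 0 <= (u *m Sstar *m u^T) 0 0
    <= l1 * (u *m u^T) 0 0 by exact: (char_poly_bounds u sS.1 cp srt).
have l10 : 0 <= l1.
  have := quad (delta_mx 0 0); rewrite trmx_delta mul_delta_mx mxE !eqxx !mulr1.
  by case/andP => /le_trans h /h; exact: le_trans (ltW ld0).
have rp : r < Num.sqrt ld - r by apply: rad_pos.
have sp : 0 < Num.sqrt ld - r := lt_trans r0 rp.
have bb S V : W2_ball Sstar r S -> sym V ->
    (Num.sqrt ld - r) * frobenius V <= bw_norm S V <= (Num.sqrt l1 + r) * frobenius V.
  move=> BS sV; have := ball_bounds sS ld0 l10 rld quad V BS.
  by rewrite frobeniusE /bw_norm /bw_inner sV.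
split.
- exact: (ball_compact sS ld0 r0 rld quad).
(* This is $3b/a^2$ for the squared norm constants $a=(\sqrt{\lambda_d^*}-r)^2$ and
   $b=(\sqrt{\lambda_1^*}+r)^2$. *)
- exists (3 * (Num.sqrt l1 + r) ^+ 2 / ((Num.sqrt ld - r) ^+ 2) ^+ 2).
  move=> S BS U V sU sV _.
  apply: sectional_curvature_bound => //; [exact: BS.1|exact: exprn_gt0|exact: sqr_ge0|].
  by move=> W; exact: (ball_trace_bounds sS ld0 l10 r0 rld quad).
- split; first exact: bb.
    move=> S1 S2 V B1 B2 sV; have /andP[h1 _] := bb _ _ B1 sV.
    have /andP[_ h2] := bb _ _ B2 sV; apply: (le_trans h2).
    rewrite -mulrA ler_wpM2l ?(addr_ge0 (sqrtr_ge0 _) (ltW r0))//.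
    by rewrite mulrC ler_pdivlMr// mulrC.
  move=> S1 S2 B1 B2; rewrite frobeniusE.
  apply: (le_trans (ball_lipschitz sS ld0 l10 r0 rld quad B1 B2)).
  rewrite ler_wpM2r ?sqrtr_ge0// -mulrA ler_pM2l//.
  (* The constant obtained is $2(\sqrt{\lambda_1^*}+r)$; the stated one is larger because
     $r<\sqrt{\lambda_d^*}$ and $1\le\sqrt2$. *)
  have s2 : 1 <= Num.sqrt 2 :> R by rewrite -{1}sqrtr1 ler_sqrt// ler1n.
  have : 0 <= Num.sqrt l1 := sqrtr_ge0 _; have : 0 <= Num.sqrt ld := sqrtr_ge0 _.
  move: rp s2 => {}rp s2; move: (Num.sqrt l1) (Num.sqrt ld) (Num.sqrt 2) rp s2 => a b c *.
  by nra.
move=> S V BS sV Vr; have /andP[h _] := bb _ _ BS sV.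
(* The lower norm bound gives $(\sqrt{\lambda_d^*}-r)\|V\|_F \le r/2 < \sqrt{\lambda_d^*}-r$, so
   $1+V$ is positive definite and hence an optimal transport map. *)
have V1 : hs_norm V < 1.
  rewrite -(ltr_pM2l sp) mulr1; apply: (le_lt_trans _ rp).
  by rewrite -frobeniusE; apply: (le_trans h); lra.
rewrite /bw_exp W2_transport; [|exact: BS.1|exact: spd_perturb].
by rewrite [1%:M + V]addrC addrK.
Qed.
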